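(* Let $\Omega \subset \mathbb R^d$ be nonempty, open, bounded and connected, and suppose that there exists $D > 0$ such that any two points $x, y \in \bar\Omega$ can be connected by a curve included in $\bar\Omega$ of length at most $D |x - y|$. Let $\Gamma \subset \bar\Omega$ be nonempty and closed. Let $k: \mathbb R_+ \times \bar\Omega \to \mathbb R_+$ be continuous and such that there exist positive constants $K_{\min}, K_{\max}$ with $k(t,x) \in [K_{\min}, K_{\max}]$ for every $(t,x) \in \mathbb R_+ \times \bar\Omega$, and a constant $L > 0$ with $|k(t,x_1) - k(t,x_2)| \le L |x_1 - x_2|$ for every $t \in \mathbb R_+$ and $x_1, x_2 \in \bar\Omega$. Let $\varphi$ be the value function of the optimal control problem $\mathrm{OCP}(k)$. Then there exists $M > 0$ such that, for every $(t_0, x_0), (t_1, x_1) \in \mathbb R_+ \times \bar\Omega$, \[ |\varphi(t_0, x_0) - \varphi(t_1, x_1)| \le M \left(|t_0 - t_1| + |x_0 - x_1|\right). \]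
   Context: $\mathbb R_+ = [0,\infty)$, $|\cdot|$ is the Euclidean norm, $\bar B$ is the closed unit ball of $\mathbb R^d$. $\mathrm{OCP}(k)$ is the following minimal-time problem with state constraint $\bar\Omega$ and target set $\Gamma$. The set $\mathrm{Adm}(k)$ of admissible curves is the set of Lipschitz continuous $\gamma: \mathbb R_+ \to \bar\Omega$ for which there is a measurable $u: \mathbb R_+ \to \bar B$ (the control associated with $\gamma$) with $\dot\gamma(t) = k(t, \gamma(t)) u(t)$ for a.e. $t \ge 0$. For a Lipschitz curve $\gamma$ and $t_0 \ge 0$, $\tau(t_0, \gamma) = \inf\{t \ge 0 : \gamma(t + t_0) \in \Gamma\}$ (equal to $+\infty$ if $\gamma$ does not meet $\Gamma$ after $t_0$). The value function is $\varphi(t_0, x_0) = \inf\{\tau(t_0, \gamma) : \gamma \in \mathrm{Adm}(k),\ \gamma(t_0) = x_0\}$ for $(t_0, x_0) \in \mathbb R_+ \times \bar\Omega$. *)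

(* Defs.v *)
From HB Require Import structures.
From mathcomp Require Import all_boot all_order all_algebra.
From mathcomp Require Import all_classical all_reals all_analysis.
From mathcomp Require Import measurable_realfun.

Set Implicit Arguments.
Unset Strict Implicit.
Unset Printing Implicit Defensive.

Import Order.TTheory GRing.Theory Num.Theory.
Import numFieldNormedType.Exports.

Local Open Scope classical_set_scope.
Local Open Scope ring_scope.

(* The library norm of 'rV[R]_d is the sup norm. It induces the same topology
   and the same bounded sets as [enorm], but metric estimates use [enorm]. *)
Definition enorm (R : realType) (d : nat) (v : 'rV[R]_d) : R :=
  Num.sqrt (\sum_(i < d) v ord0 i ^+ 2).

(* Vector-valued counterparts of [variation] and [total_variation]. *)
Definition evariation (R : realType) (d : nat) (a b : R) (c : R -> 'rV[R]_d)
    (s : seq R) : R :=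
  let F := c \o nth b (a :: s) in
  \sum_(0 <= n < size s) enorm (F n.+1 - F n).

Definition curve_length (R : realType) (d : nat) (a b : R)
    (c : R -> 'rV[R]_d) : \bar R :=
  ereal_sup [set (evariation a b c s)%:E | s in itv_partition a b].

Definition connected_by_curve (R : realType) (d : nat) (A : set 'rV[R]_d)
    (x y : 'rV[R]_d) (l : R) : Prop :=
  exists c : R -> 'rV[R]_d,
    [/\ {within `[0, 1], continuous c},
        c 0 = x, c 1 = y,
        (forall s, 0 <= s <= 1 -> A (c s)) &
        (curve_length 0 1 c <= l%:E)%E].

(* Curves and controls on [0, +oo[ are represented by functions on R, whose
   values at negative times are never used. *)
Definition lipschitz_curve (R : realType) (d : nat) (g : R -> 'rV[R]_d) :
    Prop :=
  exists C : R, forall s t : R, 0 <= s -> 0 <= t ->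
    enorm (g s - g t) <= C * `|s - t|.

(* Preimages of Borel sets of 'rV[R]_d are Lebesgue-measurable: the domain
   carries the completion of the Borel sigma-algebra of R. *)
Definition measurable_control (R : realType) (d : nat) (u : R -> 'rV[R]_d) :
    Prop :=
  measurable_fun
    (`[0, +oo[%classic :
      set (g_sigma_algebraType (completed_algebra_gen (@lebesgue_measure R))))
    (u : _ -> g_sigma_algebraType (@open 'rV[R]_d)).

Definition is_control (R : realType) (d : nat) (k : R -> 'rV[R]_d -> R)
    (g u : R -> 'rV[R]_d) : Prop :=
  [/\ measurable_control u,
      (forall t : R, 0 <= t -> enorm (u t) <= 1) &
      {ae @lebesgue_measure R, forall t : R, 0 <= t ->
        is_derive t 1 g (k t (g t) *: u t)}].

(* [Omega] is the open set; the state constraint is its closure. *)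
Definition adm (R : realType) (d : nat) (Omega : set 'rV[R]_d)
    (k : R -> 'rV[R]_d -> R) : set (R -> 'rV[R]_d) :=
  [set g | [/\ lipschitz_curve g,
               (forall t : R, 0 <= t -> closure Omega (g t)) &
               exists u : R -> 'rV[R]_d, is_control k g u]].

Definition arrival_time (R : realType) (d : nat) (Gamma : set 'rV[R]_d)
    (t0 : R) (g : R -> 'rV[R]_d) : \bar R :=
  ereal_inf [set t%:E | t in [set t : R | 0 <= t /\ Gamma (g (t + t0))]].

Definition value_function (R : realType) (d : nat)
    (Omega Gamma : set 'rV[R]_d) (k : R -> 'rV[R]_d -> R)
    (t0 : R) (x0 : 'rV[R]_d) : \bar R :=
  ereal_inf [set arrival_time Gamma t0 g |
    g in [set g | adm Omega k g /\ g t0 = x0]].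

(* Main.v *)
Require Import Defs.
From HB Require Import structures.
From mathcomp Require Import all_boot all_order all_algebra.
From mathcomp Require Import all_classical all_reals all_analysis.
From mathcomp Require Import measurable_realfun.
From mathcomp Require Import ring lra.

Set Implicit Arguments.
Unset Strict Implicit.
Unset Printing Implicit Defensive.

Import Order.TTheory GRing.Theory Num.Theory.
Import numFieldNormedType.Exports.

Local Open Scope classical_set_scope.
Local Open Scope ring_scope.

(** Why the value function is Lipschitz continuous.

    Let [g] be an admissible curve through [x0] at time [t0] which reaches
    [Gamma] at time [b = t0 + T], with [T] as close to the value as desired.
    A second traveller starts from [x1] at time [t1]. It first goes to [x0] along
    a curve of length at most [D * enorm (x1 - x0)] at the speed [Kmin], which is
    allowed everywhere, and is there by a time [a >= t0] whose delay [a - t0] is at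
    most of the order of [rho = `|t0 - t1| + enorm (x0 - x1)]. It then follows the
    path of [g].

    Imitating [g] after a translation of time would fail, since [k] is merely
    continuous in time. The two travellers are compared at the same time
    instead: if the second one is behind the first at a distance [E] measured
    along the path, the speeds allowed to them differ by at most [L * E]. Hence the
    distance [E t = Kmax * (a - t0) * expR (L * (t - t0))], which solves
    [E' = L * E], can be kept by an admissible motion once it is established; as
    the law of motion of the second traveller is explicit, no differential equation
    has to be solved. At time [b] the second traveller is at a distance at most
    [E b] from the arrival, which is of order [rho] because [T] is bounded
    uniformly, and it finishes the journey at the speed [Kmin]. The condition
    [L * E b <= Kmin] ensures that keeping the distance never requires moving
    backwards; when it fails, [rho] is bounded below and the uniform bound of the
    value function gives the estimate. The law of motion is studied in
    [pursuit_law], the curve is built in [pursuit], and the two cases are combined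
    in [value_function_le_shift].

    What remains is to pass from controls to metric speeds and back. An
    admissible curve covers at most the distance allowed by the integral [V] of
    [k t (g t)] ([adm_increment]), and [arclength_parametrization] factors it as
    a 1-Lipschitz curve composed with [V]; the same lemma makes the curves of
    finite length of the hypothesis 1-Lipschitz. Conversely [adm_of_speed] finds
    a measurable control for any Lipschitz curve in the constraint set whose
    metric speed is at most [k] almost everywhere. It rests on the almost
    everywhere differentiability of Lipschitz functions
    ([lipschitz_derivable_ae]), obtained from the Radon-Nikodym theorem and the
    Lebesgue differentiation theorem. *)

(** * The Euclidean norm *)

Lemma enorm_ge0 (R : realType) (d : nat) (v : 'rV[R]_d) : 0 <= enorm v.
Proof. exact: sqrtr_ge0. Qed.

Lemma sqr_enorm (R : realType) (d : nat) (v : 'rV[R]_d) :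
  enorm v ^+ 2 = \sum_(i < d) v ord0 i ^+ 2.
Proof. by rewrite sqr_sqrtr// sumr_ge0// => i _; rewrite sqr_ge0. Qed.

Lemma enorm0 (R : realType) (d : nat) : enorm (0 : 'rV[R]_d) = 0.
Proof.
rewrite /enorm big1 ?sqrtr0// => i _.
by rewrite mxE expr0n.
Qed.

Lemma enormZ (R : realType) (d : nat) (c : R) (v : 'rV[R]_d) :
  enorm (c *: v) = `|c| * enorm v.
Proof.
rewrite /enorm -sqrtr_sqr -sqrtrM ?sqr_ge0// mulr_sumr.
by congr Num.sqrt; apply: eq_bigr => i _; rewrite mxE exprMn.
Qed.

Lemma enormN (R : realType) (d : nat) (v : 'rV[R]_d) : enorm (- v) = enorm v.
Proof. by rewrite -scaleN1r enormZ normrN1 mul1r. Qed.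

Lemma enormC (R : realType) (d : nat) (v w : 'rV[R]_d) :
  enorm (v - w) = enorm (w - v).
Proof. by rewrite -enormN opprB. Qed.

Lemma coord_le_enorm (R : realType) (d : nat) (v : 'rV[R]_d) (i : 'I_d) :
  `|v ord0 i| <= enorm v.
Proof.
rewrite -sqrtr_sqr ler_wsqrtr// (bigD1 i)//= lerDl.
by rewrite sumr_ge0// => j _; rewrite sqr_ge0.
Qed.

Lemma enorm_eq0 (R : realType) (d : nat) (v : 'rV[R]_d) :
  enorm v <= 0 -> v = 0.
Proof.
move=> v0; apply/rowP => i; rewrite mxE; apply/eqP.
by rewrite -normr_eq0 eq_le normr_ge0 andbT (le_trans (coord_le_enorm v i)).
Qed.

(** Cauchy-Schwarz, obtained by summing the inequalities
    [2 * x * y <= t * x ^+ 2 + t^-1 * y ^+ 2] for the optimal [t]. *)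
Lemma dot_le_enorm (R : realType) (d : nat) (v w : 'rV[R]_d) :
  \sum_(i < d) v ord0 i * w ord0 i <= enorm v * enorm w.
Proof.
have [->|v0] := eqVneq v 0.
  by rewrite big1 ?mulr_ge0 ?enorm_ge0// => i _; rewrite mxE mul0r.
have [->|w0] := eqVneq w 0.
  by rewrite big1 ?mulr_ge0 ?enorm_ge0// => i _; rewrite mxE mulr0.
have nv : 0 < enorm v.
  by rewrite ltNge; apply: contra v0 => /enorm_eq0/eqP.
have nw : 0 < enorm w.
  by rewrite ltNge; apply: contra w0 => /enorm_eq0/eqP.
have t0 : 0 < enorm w / enorm v by rewrite divr_gt0.
have twice : 2 * (\sum_(i < d) v ord0 i * w ord0 i) <=
    \sum_(i < d) (enorm w / enorm v * v ord0 i ^+ 2 +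
                  (enorm w / enorm v)^-1 * w ord0 i ^+ 2).
  rewrite mulr_sumr; apply: ler_sum => i _.
  set t := enorm w / enorm v in t0 *.
  set x := v ord0 i; set y := w ord0 i.
  have -> : t * x ^+ 2 + t^-1 * y ^+ 2 = 2 * (x * y) + t^-1 * (t * x - y) ^+ 2.
    by field; rewrite gt_eqF.
  by rewrite lerDl mulr_ge0 ?sqr_ge0// invr_ge0 ltW.
suff : 2 * (\sum_(i < d) v ord0 i * w ord0 i) <= 2 * (enorm v * enorm w).
  by rewrite ler_pM2l.
rewrite (le_trans twice)// big_split/= -!mulr_sumr -!sqr_enorm le_eqVlt.
by apply/orP; left; apply/eqP; field; rewrite !gt_eqF.
Qed.

Lemma enormD (R : realType) (d : nat) (v w : 'rV[R]_d) :
  enorm (v + w) <= enorm v + enorm w.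
Proof.
rewrite -(@ler_pXn2r _ 2)// ?nnegrE ?addr_ge0 ?enorm_ge0//.
rewrite sqrrD sqr_enorm.
under eq_bigr do rewrite mxE sqrrD.
rewrite big_split big_split/= -!sqr_enorm lerD2r lerD2l sumrMnl lerMn2r/=.
exact: dot_le_enorm.
Qed.

Lemma enorm_triangle (R : realType) (d : nat) (u v w : 'rV[R]_d) :
  enorm (u - w) <= enorm (u - v) + enorm (v - w).
Proof. by rewrite (le_trans _ (enormD _ _))// addrA subrK. Qed.

Lemma norm_le_enorm (R : realType) (d : nat) (v : 'rV[R]_d) : `|v| <= enorm v.
Proof.
rewrite [leLHS]/Num.Def.normr/= mx_normrE bigmax_le ?enorm_ge0//.
by move=> [i j] _ /=; rewrite ord1 coord_le_enorm.
Qed.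

Lemma enorm_le_norm (R : realType) (d : nat) (v : 'rV[R]_d) :
  enorm v <= d%:R * `|v|.
Proof.
rewrite -(@ler_pXn2r _ 2)// ?nnegrE ?mulr_ge0 ?enorm_ge0//.
rewrite sqr_enorm (@le_trans _ _ (\sum_(i < d) `|v| ^+ 2))//.
  apply: ler_sum => i _; rewrite -real_normK ?num_real//.
  rewrite ler_pXn2r ?nnegrE//.
  rewrite [leRHS]/Num.Def.normr/= mx_normrE.
  exact: (le_bigmax _ (fun ij : 'I_1 * 'I_d => `|v ij.1 ij.2|) (ord0, i)).
rewrite sumr_const card_ord -[leLHS]mulr_natl exprMn ler_wpM2r ?sqr_ge0//.
by rewrite -natrX ler_nat; case: (d) => // n; rewrite expnS leq_pmulr.
Qed.

Lemma bounded_enorm (R : realType) (d : nat) (A : set 'rV[R]_d) :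
  bounded_set A ->
  exists2 r : R, 0 <= r &
    forall x y, closure A x -> closure A y -> enorm (x - y) <= r.
Proof.
move=> [M [_ AM]]; pose r := `|M| + 1 + 1.
have Ar x : closure A x -> `|x| <= r.
  move=> /(_ _ (nbhsx_ballx x 1 ltr01))[y [Ay]]; rewrite -ball_normE/= => xy.
  have yM : `|y| <= `|M| + 1.
    by apply: (AM _ _ y Ay); rewrite (le_lt_trans (ler_norm _))// ltrDl.
  by rewrite -[x](subrK y) (le_trans (ler_normD _ _))// addrC lerD// ltW.
have r0 : 0 <= r by rewrite addr_ge0.
exists (d%:R * (r + r)); first by rewrite mulr_ge0// addr_ge0.
move=> x y Ax Ay; rewrite (le_trans (enorm_le_norm _))// ler_wpM2l//.
by rewrite (le_trans (ler_normB _ _))// lerD// Ar.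
Qed.

(** * Estimates on the real line *)

Section RealLine.
Context {R : realType}.
Notation mu := (@lebesgue_measure R).

Lemma max_lipschitz (a x y : R) : `|Num.max a x - Num.max a y| <= `|x - y|.
Proof.
have := ler_norm (x - y); have := ler_norm (y - x); rewrite (distrC y x).
move=> ? ?; rewrite ler_norml.
by case: (leP a x) => ?; case: (leP a y) => ?; lra.
Qed.

Lemma min_lipschitz (a x y : R) : `|Num.min a x - Num.min a y| <= `|x - y|.
Proof.
have := ler_norm (x - y); have := ler_norm (y - x); rewrite (distrC y x).
move=> ? ?; rewrite ler_norml.
by case: (leP a x) => ?; case: (leP a y) => ?; lra.
Qed.

Lemma expR_lipschitz (M x y : R) : x <= M -> y <= M ->
  `|expR x - expR y| <= expR M * `|x - y|.
Proof.
wlog xy : x y / y <= x => [H xM yM|xM yM].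
  have [yx|/ltW xy] := leP y x; first exact: H.
  by rewrite distrC (distrC x); exact: H.
rewrite !ger0_norm ?subr_ge0 ?ler_expR//.
have := expR_ge1Dx (y - x); rewrite expRD expRN => yx.
have ex := expR_gt0 x.
have : expR x * (1 + (y - x)) <= expR y.
  by rewrite (le_trans (ler_wpM2l (ltW ex) yx))// mulrCA divff ?mulr1// gt_eqF.
have : expR x * (x - y) <= expR M * (x - y).
  by rewrite ler_wpM2r ?subr_ge0// ler_expR.
lra.
Qed.

Lemma lipschitz_continuous (f : R -> R) (C : R) :
  (forall x y, `|f x - f y| <= C * `|x - y|) -> continuous f.
Proof.
move=> fC x; apply/cvgrPdist_le => e e0.
have C1 : 0 < `|C| + 1 by rewrite ltr_wpDl.
near=> y.
rewrite (le_trans (fC _ _))// (@le_trans _ _ ((`|C| + 1) * `|x - y|))//.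
  by rewrite ler_wpM2r// (le_trans (ler_norm _))// lerDl.
rewrite -ler_pdivlMl//; near: y.
apply: cvgr_dist_le; last by rewrite mulr_gt0// invr_gt0.
exact: cvg_id.
Unshelve. all: by end_near. Qed.

Lemma is_derive_approx (W : normedModType R) (g : R -> W) (t : R) (w : W) :
  is_derive t 1 g w -> forall e, 0 < e ->
  \forall s \near t, `|g s - g t - (s - t) *: w| <= e * `|s - t|.
Proof.
move=> [dg gw] e e0.
have quot : h^-1 *: (g (h *: 1 + t) - g t) @[h --> (0 : R)^'] --> w.
  by rewrite -gw; exact: dg.
move/cvgrPdist_le : quot => /(_ _ e0); rewrite near_withinE => quot.
apply/(nbhs0P _ t); apply: filterS quot => h quot.
have -> : t + h - t = h by rewrite addrAC subrr add0r.
have [->|h0] := eqVneq h 0.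
  by rewrite addr0 subrr scale0r subrr !normr0 mulr0.
have -> : g (t + h) - g t - h *: w =
    (- h) *: (w - h^-1 *: (g (h *: 1 + t) - g t)).
  rewrite scalerBr scaleNr scaleNr scalerA divff// scale1r opprK addrC.
  by rewrite [_ *: (1 : R)]mulr1 [h + t]addrC.
by rewrite normrZ normrN mulrC ler_wpM2r// quot.
Qed.

Lemma ae_impl (P Q : R -> Prop) : (forall x, P x -> Q x) ->
  {ae mu, forall x, P x} -> {ae mu, forall x, Q x}.
Proof.
by move=> PQ; apply: filterS; first exact: (ae_filter_ringOfSetsType mu).
Qed.

Lemma ae_and (P Q : R -> Prop) : {ae mu, forall t, P t} ->
  {ae mu, forall t, Q t} -> {ae mu, forall t, P t /\ Q t}.
Proof. exact: (@filterI _ _ (ae_filter_ringOfSetsType mu)). Qed.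

Lemma ae_neq (r : R) : {ae mu, forall t : R, t != r}.
Proof.
exists [set r]; split => //; first exact: lebesgue_measure_set1.
by move=> t /= /negP; rewrite negbK => /eqP.
Qed.

End RealLine.

(** * Lipschitz functions of one variable are differentiable almost everywhere *)

Section Rademacher.
Context {R : realType}.
Notation mu := (@lebesgue_measure R).
Implicit Types (f : R -> R) (C : R).

(** Both sides are infima over covers by half-open intervals, on each of which
    the inequality is the Lipschitz bound. *)
Lemma lebesgue_stieltjes_le (f : cumulative R R) C (A : set R) : 0 < C ->
  (forall x y, `|f x - f y| <= C * `|x - y|) ->
  (lebesgue_stieltjes_measure f A <= C%:E * mu A)%E.
Proof.
move=> C0 fC; rewrite -lee_pdivrMl//.
apply: le_ereal_inf_tmp => _ [B [mB AB] <-].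
rewrite lee_pdivrMl//.
apply: (@le_trans _ _ (\sum_(k <oo) wlength f (B k))%E).
  by apply: ereal_inf_lbound; exists B.
rewrite -nneseriesZl; last by move=> k _; exact: measure_ge0.
apply: lee_nneseries => k _; first by move=> _; exact: measure_ge0.
have [[a b] _ /= <-] := mB k.
rewrite !wlength_itv /= !lte_fin; case: ifPn => [ab|_]; last by rewrite mule0.
rewrite -!EFinB -EFinM lee_fin (le_trans (ler_norm _))// (le_trans (fC _ _))//.
by rewrite gtr0_norm// subr_gt0.
Qed.

Lemma cumulative_of_continuous f : {homo f : x y / x <= y} -> continuous f ->
  exists F : cumulative R R, f = F.
Proof.
move=> ndf cf.
pose F : cumulative R R := HB.pack f
  (isCumulative.Build R _ R f ndf (right_continuousW cf)).
by exists F.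
Qed.

(** The Stieltjes measure of [f] has a density by [lebesgue_stieltjes_le] and the
    Radon-Nikodym theorem, and [f] is differentiable at the Lebesgue points of the
    density. The measure is restricted to [`]a, b]] because the theorem is applied
    to a finite measure. *)
Lemma nondecreasing_lipschitz_derivable_itv f C (a b : R) : 0 < C ->
  {homo f : x y / x <= y} -> (forall x y, `|f x - f y| <= C * `|x - y|) ->
  {ae mu, forall x, a < x < b -> derivable f x 1}.
Proof.
move=> C0 ndf fC.
have [F fF] := cumulative_of_continuous ndf (lipschitz_continuous fC).
have mI : measurable (`]a, b]%classic : set (measurableTypeR R)).
  exact: measurable_itv.
have FI (x y : R) : x <= y ->
    lebesgue_stieltjes_measure F `]x, y]%classic = (f y - f x)%:E.
  move=> xy; rewrite /lebesgue_stieltjes_measure /measure_extension.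
  rewrite measurable_mu_extE/=; last exact: is_ocitv.
  by rewrite wlength_itv_bnd// fF.
have [ab|ba] := ltP a b; last first.
  by apply: aeW => x /andP[ax xb]; have := lt_trans ax xb; rewrite ltNge ba.
have FIoo : (lebesgue_stieltjes_measure F `]a, b]%classic < +oo)%E.
  by rewrite FI ?ltry// ltW.
pose nu : {finite_measure set _ -> \bar R} := mfrestr mI FIoo.
have numu : nu `<< mu.
  move=> N N0 A mA AN; apply/eqP; rewrite eq_le measure_ge0 andbT.
  rewrite /nu /= /mfrestr /mrestr.
  rewrite (@le_trans _ _ (lebesgue_stieltjes_measure F A))//.
    by rewrite le_measure ?inE//; exact: measurableI.
  rewrite (le_trans (lebesgue_stieltjes_le _ C0 _))//; first by rewrite -fF.
  by rewrite N0// mule0.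
have h_fin x := Radon_Nikodym_SigmaFinite.f_fin_num numu x.
have h_int := Radon_Nikodym_SigmaFinite.f_integrable numu.
have h_nu := Radon_Nikodym_SigmaFinite.f_integral numu.
set h := Radon_Nikodym_SigmaFinite.f nu mu in h_fin h_int h_nu.
pose r x := fine (h x).
have rh : EFin \o r = h by apply/funext => x; rewrite /= fineK.
have r_int A : measurable A -> mu.-integrable A (EFin \o r).
  by move=> mA; rewrite rh; exact: integrableS h_int.
have r_loc : locally_integrable setT r.
  apply: open_integrable_locally => //; first exact: openT.
  exact: r_int.
have := FTC1 (fun y => r_int _ (measurable_itv (Interval (BRight a) (BRight y))))
  r_loc.
apply: ae_impl => x /= + /andP[ax xb] => /(_ ax)[dF _].
suff fE : {near x, (fun y => (\int[mu]_(t in `]a, y]) r t)%R + f a) =1 f}.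
  apply: (near_eq_derivable fE).
  by apply: derivableD; [exact: dF|exact: derivable_cst].
near=> y.
have ay : a <= y by apply/ltW; near: y; exact: lt_nbhsr.
have yb : y <= b by apply/ltW; near: y; exact: lt_nbhsl.
rewrite /Rintegral (_ : (\int[mu]_(t in _) (r t)%:E)%E = nu `]a, y]%classic).
  rewrite /nu /= /mfrestr /mrestr setIidl ?FI//= ?subrK//.
  by apply: subset_itvl; rewrite bnd_simp.
by rewrite h_nu; [apply: eq_integral => t _; rewrite -rh|exact: measurable_itv].
Unshelve. all: by end_near. Qed.

(** Adding a steep enough linear function makes [f] nondecreasing. *)
Lemma lipschitz_derivable_ae f C :
  (forall x y, `|f x - f y| <= C * `|x - y|) ->
  {ae mu, forall x, derivable f x 1}.
Proof.
move=> fC; have [K K0 CK] : exists2 K, 0 < K & C <= K.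
  by exists (`|C| + 1); rewrite ?ltr_wpDl// (le_trans (ler_norm _))// lerDl.
have fK x y : `|f x - f y| <= K * `|x - y|.
  by rewrite (le_trans (fC x y))// ler_wpM2r.
pose g x := f x + K * x.
have ndg : {homo g : x y / x <= y}.
  move=> x y xy; have := fK x y; rewrite /g ler_norml => /andP[_].
  rewrite ler0_norm ?subr_le0// => ?; lra.
have gK x y : `|g x - g y| <= (K + K) * `|x - y|.
  rewrite /g opprD addrACA -mulrBr (le_trans (ler_normD _ _))// mulrDl.
  by rewrite lerD// normrM gtr0_norm.
have dg n : {ae mu, forall x, - n%:R < x < n%:R -> derivable g x 1}.
  by apply: nondecreasing_lipschitz_derivable_itv ndg gK; rewrite addr_gt0.
have : {ae mu, forall x (n : nat), - n%:R < x < n%:R -> derivable g x 1}.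
  exact: ae_foralln.
apply: ae_impl => x dg_x.
have dgx : derivable g x 1.
  apply: (dg_x (Num.bound `|x|)).
  by rewrite -ltr_norml; exact: archi_boundP.
rewrite (_ : f = g - ( *%R K)).
  apply: derivableB => //.
by apply/funext => y; rewrite /g !fctE addrK.
Qed.

(** The derivative is the upper limit of difference quotients along
    the harmonic sequence, wherever it exists. *)
Lemma derive_measurable f : continuous f ->
  exists2 h : measurableTypeR R -> R, measurable_fun setT h &
    forall x, derivable f x 1 -> h x = 'D_1 f x.
Proof.
move=> cf.
pose q n x := (harmonic n)^-1 * (f (harmonic n + x) - f x).
exists (fun x => fine (limn_esup (fun n => (q n x)%:E))).
  apply: measurableT_comp; first exact: fine_measurable.
  apply: measurable_fun_limn_esup => n; apply/measurable_EFinP.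
  apply: continuous_measurable_fun => x.
  apply: cvgM; first exact: cvg_cst.
  apply: cvgB; last exact: cf.
  apply: continuous_comp; last exact: cf.
  by apply: cvgD; [exact: cvg_cst|exact: cvg_id].
move=> x df.
have qf : (q n x)%:E @[n --> \oo] --> ('D_1 f x)%:E.
  apply/cvg_EFin; first exact: nearW.
  have /cvg_dnbhs_at_right/cvg_at_rightP/(_ harmonic) := df.
  have harm : (forall n, 0 < @harmonic R n) /\ @harmonic R @ \oo --> 0.
    by split; [move=> n; exact: harmonic_gt0|exact: cvg_harmonic].
  move=> /(_ harm) /=.
  rewrite (_ : (fun n => _) = q ^~ x) //; apply/funext => n.
  by rewrite /q /= [_ *: (1 : R)]mulr1.
by rewrite is_cvg_limn_esupE ?(cvg_lim _ qf)//; apply/cvg_ex; eexists; exact: qf.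
Qed.

End Rademacher.

(** * Increments controlled almost everywhere *)

Section Increments.
Context {R : realType} {d : nat}.
Notation mu := (@lebesgue_measure R).

Lemma null_set_open_cover (N : set R) (e : R) : 0 < e -> mu.-negligible N ->
  exists U : set R, [/\ open U, N `<=` U & (mu U < e%:E)%E].
Proof.
move=> e0 [M [mM M0 NM]].
have [|U [oU MU UMe]] := @lebesgue_regularity_outer R M e mM _ e0.
  by rewrite [X in (X < _)%E]M0 ltry.
exists U; split => //; first exact: subset_trans MU.
have mU : measurable (U : set (measurableTypeR R)) by exact: open_measurable.
rewrite (le_lt_trans _ UMe)// (@le_trans _ _ (mu (U `\` M) + mu M)%E)//.
  rewrite -{1}(setDUK MU) setUC (le_trans (measureU2 _ _ _))//.
  exact: measurableD.
by rewrite M0 adde0.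
Qed.

(** The exceptional set is covered by an open set of small measure, and the
    inequality is carried from [a] to [b] with an error made of a linear term
    and of the measure of the part of the cover already visited: on the cover
    the Lipschitz bound is absorbed by the growth of that measure, elsewhere the
    hypothesis applies. *)
Lemma increment_le (g : R -> 'rV[R]_d) (V : R -> R) (a b C : R) (N : set R) :
  a <= b -> 0 <= C -> mu.-negligible N ->
  (forall s t, a <= s <= b -> a <= t <= b ->
    enorm (g s - g t) <= C * `|s - t|) ->
  (forall s t, a <= s -> s <= t -> t <= b -> V s <= V t) ->
  (forall t, a <= t < b -> ~ N t -> forall e, 0 < e ->
    \forall s \near t^'+, enorm (g s - g t) <= V s - V t + e * (s - t)) ->
  enorm (g b - g a) <= V b - V a.
Proof.
move=> ab C0 N0 gC ndV gV.
suff H e : 0 < e -> enorm (g b - g a) <= V b - V a + e * (b - a) + C * e.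
  apply/ler_addgt0Pr => e e0.
  have K0 : 0 < b - a + C + 1 by rewrite ltr_wpDl// addr_ge0// subr_ge0.
  have eK : 0 < e / (b - a + C + 1) by rewrite divr_gt0.
  rewrite (le_trans (H _ eK))// -addrA lerD2l.
  rewrite [leRHS](_ : _ = e / (b - a + C + 1) * (b - a + C + 1)); last first.
    by rewrite divfK// gt_eqF.
  by rewrite [C * _]mulrC -mulrDr ler_wpM2l ?(ltW eK)// lerDl.
move=> e0.
have [U [oU NU Ue]] := null_set_open_cover e0 N0.
have mUI (i : interval R) :
    measurable (U `&` [set` i] : set (measurableTypeR R)).
  by apply: measurableI; [exact: open_measurable|exact: measurable_itv].
have muUI (i : interval R) : (mu (U `&` [set` i]) < e%:E)%E.
  by rewrite (le_lt_trans _ Ue)// le_measure ?inE//; exact: open_measurable.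
have muUI_fin (i : interval R) : mu (U `&` [set` i]) \is a fin_num.
  by rewrite ge0_fin_numE// (lt_trans (muUI i))// ltry.
pose W t := fine (mu (U `&` `[a, t]%classic)).
have We t : W t < e by rewrite -lte_fin fineK.
have ndW s t : s <= t -> W s <= W t.
  move=> st; rewrite fine_le// le_measure ?inE//.
  by apply: setIS; apply: subset_itvl; rewrite bnd_simp.
have WD s t : a <= s -> s <= t -> `]s, t]%classic `<=` U -> W s + (t - s) <= W t.
  move=> as_ st stU; rewrite -lee_fin EFinD !fineK//.
  have -> : (t - s)%:E = mu `]s, t]%classic.
    rewrite lebesgue_measure_itv/= lte_fin; case: ltP => //.
    by move=> ts; rewrite (le_anti (introT andP (conj st ts))) subrr.
  rewrite -measureU//=.
  - rewrite le_measure ?inE//; first exact: measurableU.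
    move=> x [[Ux]|]; rewrite /= !in_itv/=.
      by move=> /andP[-> xs]; rewrite (le_trans xs).
    move=> /andP[sx xt]; split; first by apply: stU; rewrite /= in_itv/= sx.
    by rewrite xt (le_trans as_)// ltW.
  - apply/seteqP; split => // x [[_]]; rewrite /= !in_itv/=.
    by move=> /andP[_ xs] /andP[]; rewrite ltNge xs.
pose S := [set t | a <= t <= b /\
  enorm (g t - g a) <= V t - V a + e * (t - a) + C * W t].
have Sa : S a.
  rewrite /S/= lexx ab !subrr enorm0; split => //.
  by rewrite mulr0 !add0r mulr_ge0// fine_ge0.
have Sub : ubound S b by move=> t [/andP[]].
have Ssup : has_sup S by split; [exists a|exists b].
pose T := sup S.
have aT : a <= T by apply: ub_le_sup => //; exists b.
have Tb : T <= b by apply: ge_sup => //; exists a.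
have step s t : S s -> s <= t -> t <= b ->
    enorm (g t - g s) <= V t - V s + e * (t - s) + C * (W t - W s) -> S t.
  move=> [/andP[as_ sb] Ss] st tb gst; split.
    by rewrite tb (le_trans as_).
  rewrite (le_trans (enorm_triangle _ (g s) _))//.
  by rewrite (le_trans (lerD gst Ss))//; lra.
(* the supremum belongs to [S], by the Lipschitz bound on [g] *)
have ST : S T.
  split; first by rewrite aT.
  apply/ler_addgt0Pr => h h0.
  have hC : 0 < h / (C + 1) by rewrite divr_gt0// ltr_wpDl.
  have [s [/andP[as_ sb] Ss] Ths] := sup_adherent hC Ssup.
  have sT : s <= T by apply: ub_le_sup; [exists b|split => //; rewrite as_].
  rewrite (le_trans (enorm_triangle _ (g s) _))//.
  have gTs : enorm (g T - g s) <= h.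
    rewrite (le_trans (gC _ _ _ _)) ?aT ?as_// ger0_norm ?subr_ge0//.
    have : (C + 1) * (T - s) <= h.
      by rewrite mulrC -ler_pdivlMr ?ltr_wpDl// lerBlDl -lerBlDr ltW.
    apply: le_trans; rewrite ler_wpM2r ?subr_ge0// lerDl//.
  rewrite (le_trans (lerD gTs Ss))//.
  have := ndV _ _ as_ sT Tb.
  have := ler_wpM2l C0 (ndW _ _ sT).
  have : e * (s - a) <= e * (T - a) by rewrite ler_wpM2l ?lerD2r// ltW.
  lra.
have [<-|Tneb] := eqVneq T b.
  have [_ /le_trans] := ST; apply; rewrite lerD2l ler_wpM2l//.
  exact/ltW/We.
have {Tneb} Tltb : T < b by rewrite lt_neqAle Tneb.
exfalso.
suff [s [Ts sb Ss]] : exists s, [/\ T < s, s <= b & S s].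
  have : s <= T by apply: ub_le_sup => //; exists b.
  by rewrite leNgt Ts.
(* on the cover, [W] grows at unit rate and pays for the Lipschitz bound *)
have [UT|UT] := pselect (U T).
  have /nbhs_ballP[r /= r0 rU] : nbhs T U by exact: open_nbhs_nbhs.
  pose s := Num.min b (T + r / 2).
  have Ts : T < s by rewrite lt_min Tltb ltrDl divr_gt0.
  have sb : s <= b by rewrite ge_min lexx.
  have sr : s <= T + r / 2 by rewrite ge_min lexx orbT.
  exists s; split => //; apply: (step T) => //; first exact: ltW.
  rewrite (le_trans (gC _ _ _ _)) ?aT ?sb ?(le_trans aT) ?(ltW Ts)//.
  rewrite gtr0_norm ?subr_gt0//.
  have := ndV _ _ aT (ltW Ts) sb.
  have : 0 <= e * (s - T) by rewrite mulr_ge0 ?subr_ge0 ?(ltW Ts) ?(ltW e0).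
  have := WD _ _ aT (ltW Ts).
  have TsU : `]T, s]%classic `<=` U.
    move=> x; rewrite /= in_itv/= => /andP[Tx xs]; apply: rU.
    rewrite /ball/= ltr0_norm ?subr_lt0// opprB ltrBlDl.
    rewrite (le_lt_trans xs)// (le_lt_trans sr)// ltrD2l.
    by rewrite ltr_pdivrMr// ltr_pMr// ltr1n.
  move=> /(_ TsU) WTs.
  have : C * (s - T) <= C * (W s - W T) by rewrite ler_wpM2l//; lra.
  lra.
have NT : ~ N T by move=> /NU.
have aTb : a <= T < b by rewrite aT.
have near_s := gV T aTb NT e e0.
have : \forall s \near T^'+, S s /\ T < s <= b.
  near=> s.
  have Ts : T < s by near: s; exact: nbhs_right_gt.
  have sb : s <= b by near: s; exact: nbhs_right_le.
  split; last by rewrite Ts.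
  apply: (step _ _ ST (ltW Ts) sb).
  have : enorm (g s - g T) <= V s - V T + e * (s - T).
    by near: s; exact: near_s.
  have : 0 <= C * (W s - W T) by rewrite mulr_ge0// subr_ge0 ndW// ltW.
  lra.
by move=> /filter_ex[s [Ss /andP[Ts sb]]]; exists s.
Unshelve. all: by end_near. Qed.

End Increments.

(** * Parametrization by arclength *)

Section Arclength.
Context {R : realType} {d : nat}.

(** [X l] is the point of the curve at the supremum of the times where [V <= l]:
    where [V] jumps over an interval of values, [X] is constant there, so that [V]
    need not be continuous. *)
Lemma arclength_parametrization (c : R -> 'rV[R]_d) (V : R -> R) (a b : R) :
  a <= b ->
  (forall t, a <= t <= b -> forall e, 0 < e ->
    \forall s \near t, a <= s <= b -> enorm (c s - c t) <= e) ->
  (forall s t, a <= s -> s <= t -> t <= b -> enorm (c t - c s) <= V t - V s) ->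
  exists X : R -> 'rV[R]_d,
    [/\ (forall l, exists2 t, a <= t <= b & X l = c t),
        (forall l m, enorm (X l - X m) <= `|l - m|),
        (forall t, a <= t <= b -> X (V t) = c t),
        (forall l, l <= V a -> X l = c a) &
        (forall l, V b <= l -> X l = c b)].
Proof.
move=> ab cc cV.
have ndV s t : a <= s -> s <= t -> t <= b -> V s <= V t.
  by move=> as_ st tb; rewrite -subr_ge0 (le_trans _ (cV _ _ as_ st tb)) ?enorm_ge0.
pose S l := [set t | a <= t <= b /\ (t = a \/ V t <= l)].
have Sa l : S l a by split; [rewrite lexx|left].
have Sub l : ubound (S l) b by move=> t [/andP[]].
have Ssup l : has_sup (S l) by split; [exists a|exists b].
pose T l := sup (S l).
have ST l t : S l t -> t <= T l by move=> St; apply: ub_le_sup => //; exists b.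
have aTb l : a <= T l <= b.
  by rewrite ST//=; apply: ge_sup => //; exists a.
have approx l x e : 0 < e -> x < T l ->
    exists s, [/\ x < s, s <= T l, S l s & enorm (c s - c (T l)) <= e].
  move=> e0 xT; have /nbhs_ballP[r /= r0 rc] := cc _ (aTb l) _ e0.
  have m0 : 0 < Num.min r (T l - x) by rewrite lt_min r0 subr_gt0.
  have [s Ss sT] := sup_adherent m0 (Ssup l).
  have sTl := ST _ _ Ss.
  exists s; split => //.
    have : Num.min r (T l - x) <= T l - x by rewrite ge_min lexx orbT.
    rewrite -/(T l) in sT; lra.
  apply: rc; last by case: Ss.
  rewrite /ball/= ger0_norm ?subr_ge0// ltrBlDr -ltrBlDl.
  by rewrite (le_lt_trans _ sT)// lerB// ge_min lexx.
have XV t : a <= t <= b -> c (T (V t)) = c t.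
  move=> tab; have tT : t <= T (V t) by apply: ST; split => //; right.
  apply/eqP; rewrite -subr_eq0; apply/eqP/enorm_eq0/ler_addgt0Pr => e e0.
  rewrite add0r.
  have [tE|tneT] := eqVneq t (T (V t)).
    by rewrite -tE subrr enorm0 ltW.
  have tltT : t < T (V t) by rewrite lt_neqAle tneT.
  have [s [ts sT [/andP[as_ sb] Ss] cs]] := approx (V t) t e e0 tltT.
  suff -> : c t = c s by rewrite enormC.
  have /andP[at_ tb] := tab.
  have Vst : V s <= V t.
    by case: Ss => // sa; move: ts; rewrite sa ltNge at_.
  apply/esym/eqP; rewrite -subr_eq0; apply/eqP/enorm_eq0.
  by rewrite (le_trans (cV _ _ at_ (ltW ts) sb))// subr_le0.
have lip l m : l <= m -> enorm (c (T m) - c (T l)) <= m - l.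
  move=> lm.
  have Tlm : T l <= T m.
    apply: sup_le; [|by exists a|by []].
    move=> t [tab tl]; exists t; split => //; split => //.
    by case: tl => [->|tl]; [left|right; exact: le_trans lm].
  have [->|Tne] := eqVneq (T m) (T l); first by rewrite subrr enorm0 subr_ge0.
  have {Tne Tlm}Tlt : T l < T m by rewrite lt_neqAle eq_sym Tne.
  apply/ler_addgt0Pr => e e0.
  have e2 : 0 < e / 2 by rewrite divr_gt0.
  have /andP[aT Tb] := aTb l.
  have : \forall s \near (T l)^'+,
      [/\ T l < s, s < T m & enorm (c s - c (T l)) <= e / 2].
    have near_c : \forall s \near (T l)^'+,
        a <= s <= b -> enorm (c s - c (T l)) <= e / 2.
      by apply: cvg_within; exact: (cc _ (aTb l) _ e2).
    near=> s.
    have Ts : T l < s by near: s; exact: nbhs_right_gt.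
    have sT : s < T m by near: s; exact: nbhs_right_lt.
    split => //.
    have : a <= s <= b -> enorm (c s - c (T l)) <= e / 2 by near: s.
    apply; rewrite (le_trans aT (ltW Ts))/= (le_trans (ltW sT))//.
    by have /andP[] := aTb m.
  move=> /filter_ex[s [Ts sT cs]].
  (* just after [T l] the values of [V] exceed [l], just before [T m] some are
     at most [m] *)
  have [s' [ss' s'T [/andP[as' s'b] Ss'] cs']] := approx m s _ e2 sT.
  have as_ : a <= s by rewrite (le_trans aT)// ltW.
  have lVs : l < V s.
    rewrite ltNge; apply: contraTN Ts => Vs; rewrite -leNgt ST//; split.
      by rewrite as_ (le_trans (ltW ss')).
    by right.
  have Vs'm : V s' <= m.
    case: Ss' => // s'a; move: ss'; rewrite s'a ltNge.
    by rewrite as_.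
  have := cV _ _ as_ (ltW ss') s'b.
  have := enorm_triangle (c (T m)) (c s') (c (T l)).
  have := enorm_triangle (c s') (c s) (c (T l)).
  rewrite [enorm (c (T m) - c s')]enormC.
  lra.
exists (c \o T); split => /=.
- by move=> l; exists (T l).
- move=> l m; have [lm|/ltW ml] := leP l m.
    by rewrite enormC ler0_norm ?subr_le0// opprB lip.
  by rewrite ger0_norm ?subr_ge0// lip.
- exact: XV.
- move=> l; rewrite le_eqVlt => /predU1P[->|lVa]; first by rewrite XV// lexx.
  congr c; apply: le_anti; have /andP[-> _] := aTb l; rewrite andbT.
  apply: ge_sup; first by exists a.
  move=> t [/andP[at_ tb] [->//|Vt]].
  by have := lt_le_trans lVa (le_trans (ndV _ _ (lexx a) at_ tb) Vt); rewrite ltxx.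
- move=> l Vbl; congr c; apply: le_anti; have /andP[_ ->] := aTb l.
  by rewrite ST//; split; [rewrite ab lexx|right].
Unshelve. all: by end_near. Qed.

(** The variation along [0, t] serves as [V]: extending a partition of [0, s] by
    the point [t] shows that it grows by at least the distance travelled. *)
Lemma geodesic_parametrization (A : set 'rV[R]_d) (x y : 'rV[R]_d) (l : R) :
  connected_by_curve A x y l ->
  exists X : R -> 'rV[R]_d,
    [/\ (forall s, A (X s)),
        (forall s t, enorm (X s - X t) <= `|s - t|), X 0 = x & X l = y].
Proof.
move=> [c [cc c0 c1 cA cl]].
pose P t := [set evariation 0 t c s | s in itv_partition 0 t].
have evar_rcons (s t : R) p : itv_partition 0 s p -> s < t ->
    itv_partition 0 t (rcons p t) /\
    evariation 0 t c (rcons p t) = evariation 0 s c p + enorm (c t - c s).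
  move=> [pp /eqP ps] st; split.
    by split; rewrite ?last_rcons// rcons_path pp ps.
  have nth_p i : (i <= size p)%N -> nth t (0 :: rcons p t) i = nth s (0 :: p) i.
    move=> ip; rewrite -rcons_cons nth_rcons/= ltnS ip.
    by rewrite (set_nth_default s).
  have last_p : nth s (0 :: p) (size p) = s by rewrite nth_last/= ps.
  rewrite /evariation size_rcons big_nat_recr//=; congr (_ + _); last first.
    by rewrite nth_rcons ltnn eqxx nth_p// last_p.
  apply: eq_big_nat => i /andP[_ ip].
  by rewrite -[nth t _ i]/(nth t (0 :: rcons p t) i.+1) !nth_p// ltnW.
have P0 p : itv_partition (0 : R) 0 p -> evariation 0 0 c p = 0.
  by move=> /itv_partitionxx ->; rewrite /evariation big_nil.
have Pl t p : 0 <= t -> t <= 1 -> itv_partition 0 t p -> evariation 0 t c p <= l.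
  move=> t0 t1 tp.
  have bound q : itv_partition 0 1 q -> evariation 0 1 c q <= l.
    move=> qp; rewrite -lee_fin (le_trans _ cl)//.
    by apply: ereal_sup_ubound; exists q.
  have [t1E|t1'] := eqVneq t 1; first by rewrite t1E in tp *; exact: bound.
  have tlt1 : t < 1 by rewrite lt_neqAle t1'.
  have [rp rE] := evar_rcons _ _ _ tp tlt1.
  by rewrite (le_trans _ (bound _ rp))// rE lerDl enorm_ge0.
have Pn t : 0 <= t -> P t !=set0.
  move=> t0; have [<-|tn] := eqVneq 0 t.
    by exists (evariation 0 0 c [::]); exists [::] => //; split => /=.
  exists (evariation 0 t c [:: t]), [:: t] => //.
  by apply: itv_partition1; rewrite lt_neqAle tn.
have Psup t : 0 <= t -> t <= 1 -> has_sup (P t).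
  move=> t0 t1; split; first exact: Pn.
  by exists l => _ [p pp <-]; exact: Pl.
pose V t := sup (P t).
have V1 : V 1 <= l.
  by apply: ge_sup; [exact: Pn|move=> _ [p pp <-]; exact: Pl].
have V0 : 0 <= V 0.
  apply: ub_le_sup; first by have [] := Psup 0 (lexx _) ler01.
  by exists [::]; [split|exact: P0].
have [|t t01 e e0|s t s0 st t1|X [XA Xlip _ X0 X1]] :=
    @arclength_parametrization c V 0 1.
- exact: ler01.
- have t01' : `[0, 1]%classic t by rewrite /= in_itv.
  have ed : 0 < e / (d%:R + 1) by rewrite divr_gt0// ltr_wpDl.
  have /subspace_continuousP/(_ t t01')/cvgrPdist_le/(_ _ ed) := cc.
  rewrite near_withinE; apply: filterS => s sct s01.
  rewrite (le_trans (enorm_le_norm _))// distrC.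
  rewrite (@le_trans _ _ (d%:R * (e / (d%:R + 1))))//.
    by rewrite ler_wpM2l// sct//= in_itv.
  by rewrite mulrCA ger_pMr// ler_pdivrMr ?ltr_wpDl// mul1r lerDl.
- have [->|snt] := eqVneq s t; first by rewrite !subrr enorm0.
  have slt : s < t by rewrite lt_neqAle snt.
  rewrite lerBrDr addrC -lerBrDr; apply: ge_sup; first exact: Pn.
  move=> _ [p pp <-]; have [rp rE] := evar_rcons _ _ _ pp slt.
  rewrite lerBrDr -rE; apply: ub_le_sup; last by exists (rcons p t).
  by have [] := Psup t (le_trans s0 st) t1.
exists X; split.
- by move=> s; have [t t01 ->] := XA s; exact: cA.
- exact: Xlip.
- by rewrite X0.
- by rewrite X1.
Qed.

End Arclength.

(** * Metric speed of curves *)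

Section Speed.
Context {R : realType} {d : nat}.
Implicit Types (g : R -> 'rV[R]_d) (w : 'rV[R]_d).

Lemma is_derive_enorm g (t : R) w : is_derive t 1 g w -> forall e, 0 < e ->
  \forall s \near t, enorm (g s - g t - (s - t) *: w) <= e * `|s - t|.
Proof.
move=> gw e e0.
have ed : 0 < e / (d%:R + 1) by rewrite divr_gt0// ltr_wpDl.
apply: filterS (is_derive_approx gw ed) => s gs.
rewrite (le_trans (enorm_le_norm _))//.
rewrite (@le_trans _ _ (d%:R * (e / (d%:R + 1) * `|s - t|)))//.
  by rewrite ler_wpM2l.
rewrite mulrA ler_wpM2r// mulrCA ger_pMr//.
by rewrite ler_pdivrMr ?ltr_wpDl// mul1r lerDl.
Qed.

Lemma derive_enorm_le g (t : R) w (r : R) : is_derive t 1 g w ->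
  (forall e, 0 < e -> \forall s \near t,
    enorm (g s - g t) <= (r + e) * `|s - t|) ->
  enorm w <= r.
Proof.
move=> gw gr; apply/ler_addgt0Pr => e e0.
have e2 : 0 < e / 2 by rewrite divr_gt0.
have : \forall s \near t^'+, t < s /\ enorm w <= r + e.
  have near_w : \forall s \near t^'+,
      enorm (g s - g t - (s - t) *: w) <= e / 2 * `|s - t|.
    by apply: cvg_within; exact: (is_derive_enorm gw e2).
  have near_r : \forall s \near t^'+, enorm (g s - g t) <= (r + e / 2) * `|s - t|.
    by apply: cvg_within; exact: gr.
  near=> s.
  have ts : t < s by near: s; exact: nbhs_right_gt.
  have st0 : 0 < s - t by rewrite subr_gt0.
  split => //; rewrite -(ler_pM2r st0).
  have h1 : enorm (g s - g t - (s - t) *: w) <= e / 2 * `|s - t|.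
    by near: s; exact: near_w.
  have h2 : enorm (g s - g t) <= (r + e / 2) * `|s - t|.
    by near: s; exact: near_r.
  have := enorm_triangle ((s - t) *: w) (g s - g t) 0.
  rewrite !subr0 enormZ [enorm (_ *: w - _)]enormC.
  move: h1 h2; rewrite (gtr0_norm st0) => h1 h2 h3.
  apply: (@le_trans _ _ (e / 2 * (s - t) + (r + e / 2) * (s - t))).
    by rewrite mulrC; exact: le_trans h3 (lerD h1 h2).
  by rewrite -mulrDl addrCA -splitr.
by move=> /filter_ex[s []].
Unshelve. all: by end_near. Qed.

(** Every open set is a countable union of boxes with rational data. *)
Lemma measurable_coordinates (u : R -> 'rV[R]_d) :
  (forall i, measurable_fun setT (fun t : measurableTypeR R => u t ord0 i)) ->
  measurable_control u.
Proof.
move=> mu_.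
have mu' : @measurable_fun _ _ (measurableTypeR R)
    (g_sigma_algebraType (@open 'rV[R]_d)) setT u.
  refine (@measurability _ _ (measurableTypeR R)
    (g_sigma_algebraType (@open 'rV[R]_d)) setT u (@open 'rV[R]_d) erefl _).
  move=> _ [U oU <-].
  rewrite setTI.
  pose box (qn : 'rV[rat]_d * nat) :=
    [set y : 'rV[R]_d | forall i, `|y ord0 i - ratr (qn.1 ord0 i)| < harmonic qn.2].
  have -> : u @^-1` U = \bigcup_qn
      (if pselect (box qn `<=` U) then u @^-1` box qn else set0).
    apply/seteqP; split => [t Ut|t [qn _]]; last first.
      by case: pselect => // bO; exact: bO.
    have /nbhs_ballP[r /= r0 rU] : nbhs (u t) U by exact: open_nbhs_nbhs.
    have r2 : 0 < r / 2 by rewrite divr_gt0.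
    have [n nr] : exists n, @harmonic R n < r / 2.
      have /cvgrPdist_lt/(_ _ r2)[n _ nr] := @cvg_harmonic R.
      exists n; have := nr n (leqnn n); rewrite /= sub0r normrN.
      by apply: le_lt_trans; exact: ler_norm.
    have q_ex i : exists q : rat, `|u t ord0 i - ratr q| < @harmonic R n.
      have : u t ord0 i - harmonic n < u t ord0 i + @harmonic R n.
        by rewrite ltrBlDr -addrA ltrDl addr_gt0// harmonic_gt0.
      move=> /rat_in_itvoo[q]; rewrite in_itv/= => /andP[q1 q2].
      by exists q; rewrite ltr_distlC; rewrite q1 q2.
    have [q qP] := choice q_ex.
    exists (\row_i q i, n) => //; case: pselect => [_|] /=.
      by move=> i; rewrite mxE.
    case=> y yb; apply: rU; rewrite -ball_normE/=.
    rewrite [ltLHS]/Num.Def.normr/= mx_normrE bigmax_lt// => -[j i] _ /=.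
    rewrite ord1 !mxE (splitr r).
    have := ler_distD (ratr (q i)) (u t ord0 i) (y ord0 i).
    move=> /le_lt_trans; apply; rewrite ltrD//.
      by rewrite (lt_trans (qP i)).
    have := yb i; rewrite mxE/= distrC => /lt_trans; exact.
  apply: countable_bigcupT_measurable; first by [].
  move=> qn; case: pselect => [? |? ] /=; last exact: measurable0.
  have -> : u @^-1` box qn = \bigcap_(i in [set: 'I_d])
      ((fun t => u t ord0 i) @^-1` ball (ratr (qn.1 ord0 i) : R) (harmonic qn.2)).
    apply/seteqP; split => t tb.
      by move=> i _ /=; rewrite /ball/= distrC; exact: tb.
    by move=> i; have := tb i I; rewrite /= /ball/= distrC.
  apply: fin_bigcap_measurable => // i _.
  by rewrite -[X in measurable X]setTI; apply: mu_ => //; exact: measurable_ball.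
move=> mD Y mY.
apply: sub_sigma_algebra; exists (`[0, +oo[%classic `&` u @^-1` Y).
  apply: measurableI; first exact: measurable_itv.
  by rewrite -[X in measurable X]setTI; exact: mu'.
by exists set0; rewrite ?setU0//; exact: negligible_set0.
Qed.

Lemma clamp_ge0 (t : R) : 0 <= Num.max 0 t.
Proof. by rewrite le_max lexx. Qed.

Lemma near_gt0_clamp (t : R) : 0 < t -> \forall s \near t, Num.max 0 s = s.
Proof.
move=> t0; near=> s; apply/max_idPr/ltW; near: s; exact: lt_nbhsr.
Unshelve. all: by end_near. Qed.

(** Clamping the time at [0] extends the speed bound along [g] to a continuous
    function on the whole line. *)
Lemma curve_speed_continuous (Omega : set 'rV[R]_d) (k : R -> 'rV[R]_d -> R) g :
  {within [set z : R * 'rV[R]_d | 0 <= z.1 /\ closure Omega z.2],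
     continuous (fun z : R * 'rV[R]_d => k z.1 z.2)} ->
  lipschitz_curve g -> (forall t, 0 <= t -> closure Omega (g t)) ->
  continuous (fun t : R => k (Num.max 0 t) (g (Num.max 0 t))).
Proof.
move=> kc [C gC] gO t.
pose h (s : R) := (Num.max 0 s, g (Num.max 0 s)).
have hA s : 0 <= (h s).1 /\ closure Omega (h s).2.
  by split => /=; [exact: clamp_ge0|apply: gO; exact: clamp_ge0].
have c1 : Num.max 0 s @[s --> t] --> Num.max 0 t.
  apply: (@lipschitz_continuous R (Num.max 0) 1) => x y.
  by rewrite mul1r max_lipschitz.
have c2 : g (Num.max 0 s) @[s --> t] --> g (Num.max 0 t).
  apply/cvgrPdist_le => e e0.
  have C1 : 0 < `|C| + 1 by rewrite ltr_wpDl.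
  near=> s.
  rewrite (le_trans (norm_le_enorm _))// (le_trans (gC _ _ _ _)) ?clamp_ge0//.
  rewrite (@le_trans _ _ ((`|C| + 1) * `|t - s|))//.
    rewrite (@le_trans _ _ ((`|C| + 1) * `|Num.max 0 t - Num.max 0 s|))//.
      by rewrite ler_wpM2r// (le_trans (ler_norm _))// lerDl.
    by rewrite ler_wpM2l ?max_lipschitz// ltW.
  rewrite -ler_pdivlMl//; near: s.
  apply: cvgr_dist_le; last by rewrite mulr_gt0// invr_gt0.
  exact: cvg_id.
have hc : h s @[s --> t] --> h t by exact: cvg_pair c1 c2.
have /subspace_continuousP/(_ _ (hA t)) kt := kc.
apply: (cvg_trans _ kt) => U /= /hc.
rewrite /= !nbhs_simpl/=; apply: filterS => s.
by move=> /(_ (hA s)).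
Unshelve. all: by end_near. Qed.

End Speed.

(** * A metric criterion of admissibility *)

Section Admissible.
Context {R : realType} {d : nat}.
Notation mu := (@lebesgue_measure R).
Implicit Types (g : R -> 'rV[R]_d) (Omega : set 'rV[R]_d).

(** A Lipschitz curve in the constraint set is admissible as soon as its metric
    speed is at most [k] almost everywhere: it is then differentiable almost
    everywhere, and the control is its velocity divided by [k]. *)
Lemma adm_of_speed Omega (k : R -> 'rV[R]_d -> R) g :
  {within [set z : R * 'rV[R]_d | 0 <= z.1 /\ closure Omega z.2],
     continuous (fun z : R * 'rV[R]_d => k z.1 z.2)} ->
  (forall t x, 0 <= t -> closure Omega x -> 0 < k t x) ->
  lipschitz_curve g -> (forall t, 0 <= t -> closure Omega (g t)) ->
  {ae mu, forall t : R, 0 < t -> forall e, 0 < e ->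
    \forall s \near t, enorm (g s - g t) <= (k t (g t) + e) * `|s - t|} ->
  adm Omega k g.
Proof.
move=> kc k0 gL gO g_speed; split => //.
have kapc := curve_speed_continuous kc gL gO.
set kap := (fun t => k _ _) in kapc.
have kap0 t : 0 < kap t.
  by apply: k0; [|apply: gO]; exact: clamp_ge0.
have kapE t : 0 <= t -> kap t = k t (g t).
  by move=> t0; rewrite /kap (max_idPr t0).
have [C gC] := gL.
pose f i t := g (Num.max 0 t) ord0 i.
have fC i x y : `|f i x - f i y| <= `|C| * `|x - y|.
  rewrite /f; set s := Num.max 0 x; set t := Num.max 0 y.
  have := coord_le_enorm (g s - g t) i; rewrite !mxE => /le_trans; apply.
  rewrite (le_trans (gC _ _ _ _)) ?clamp_ge0//.
  rewrite (@le_trans _ _ (`|C| * `|s - t|))//.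
    by rewrite ler_wpM2r// ler_norm.
  by rewrite ler_wpM2l// max_lipschitz.
have hP i : exists h : measurableTypeR R -> R, measurable_fun setT h /\
    forall x, derivable (f i) x 1 -> h x = 'D_1 (f i) x.
  by have [h h1 h2] := derive_measurable (lipschitz_continuous (fC i)); exists h.
have [h hP'] := choice hP.
pose v t : 'rV[R]_d := (kap t)^-1 *: \row_i h i t.
(* the velocity is only bounded by the speed almost everywhere, whereas a
   control has norm at most [1] at all times *)
pose u t := if \sum_(i < d) v t ord0 i ^+ 2 <= 1 then v t else 0.
have u1 t : enorm (v t) <= 1 -> u t = v t.
  by move=> vt; rewrite /u -sqr_enorm expr_le1 ?enorm_ge0// vt.
have mv i : measurable_fun setT (fun t : measurableTypeR R => v t ord0 i).
  under eq_fun do rewrite !mxE.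
  apply: measurable_funM; last by have [] := hP' i.
  apply: measurable_funTS; apply: continuous_measurable_fun => t.
  by apply: cvgV; [rewrite gt_eqF|exact: kapc].
exists u; split.
- apply: measurable_coordinates => i.
  rewrite (_ : (fun t => _) = fun t =>
      if \sum_(i < d) v t ord0 i ^+ 2 <= 1 then v t ord0 i else 0); last first.
    by apply/funext => t; rewrite /u; case: ifP => // _; rewrite mxE.
  apply: measurable_fun_ifT => //.
  apply: measurable_fun_ler => //.
  apply: measurable_sum => j.
  by apply: measurable_funX.
- move=> t _; rewrite /u -sqr_enorm expr_le1 ?enorm_ge0//.
  by case: ifP => //; rewrite enorm0.
have ae_f : {ae mu, forall t, forall i, derivable (f i) t 1}.
  apply: (@filter_forall _ _ _ _ (ae_filter_ringOfSetsType mu)) => i.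
  exact: lipschitz_derivable_ae (fC i).
apply: ae_impl (ae_and (ae_and ae_f (ae_neq 0)) g_speed) => t [[ft t0'] gt] t0.
have {}t0 : 0 < t by rewrite lt_neqAle eq_sym t0'.
have dg : is_derive t 1 g (\row_i h i t).
  have gE : {near t, (fun s : R => g (Num.max 0 s)) =1 g}.
    by apply: filterS (near_gt0_clamp t0) => s ->.
  apply: (near_eq_is_derive gE).
  have dg0 : derivable (fun s : R => g (Num.max 0 s)) t 1.
    by apply/derivable_mxP => i j; rewrite (ord1 i); exact: ft.
  apply: DeriveDef => //; rewrite derive_mx//; apply/rowP => i.
  by rewrite !mxE (hP' i).2.
suff hk : enorm (\row_i h i t) <= kap t.
  rewrite u1; first by rewrite /v -kapE ?ltW// scalerA divff ?scale1r// gt_eqF.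
  by rewrite /v enormZ gtr0_norm ?invr_gt0// ler_pdivrMl// mulr1.
apply: derive_enorm_le dg _ => e e0.
by rewrite kapE ?ltW//; exact: gt.
Qed.

End Admissible.

(** * Distance allowed by the speed bound *)

Section Primitive.
Context {R : realType}.
Notation mu := (@lebesgue_measure R).

(** Integrating from [-1] makes [0] an interior point, as a two-sided derivative
    requires. *)
Lemma continuous_primitive (kap : R -> R) : continuous kap ->
  exists V : R -> R, forall t : R, 0 <= t -> is_derive t 1 V (kap t).
Proof.
move=> kapc.
exists (fun t => \int[mu]_(s in `[-1, t]) kap s)%R => t t0.
have intk : mu.-integrable `[-1, t + 1] (EFin \o kap).
  apply: continuous_compact_integrable; first exact: segment_compact.
  exact: continuous_subspaceT.
have tt1 : t < t + 1 by rewrite ltrDl.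
have m1t : (BLeft (-1)%R < BRight t)%E by rewrite /= lte_fin; lra.
have [dV VE] := continuous_FTC1 tt1 intk m1t (kapc t).
by apply: DeriveDef => //; rewrite -derive1E.
Qed.

Lemma primitive_increment (V kap : R -> R) (m M : R) :
  (forall t : R, 0 <= t -> is_derive t 1 V (kap t)) ->
  (forall t : R, 0 <= t -> m <= kap t <= M) ->
  forall s t, 0 <= s -> s <= t -> m * (t - s) <= V t - V s <= M * (t - s).
Proof.
move=> dV mM s t s0 st.
have [x xst||c cst ->] := @MVT_segment R V kap s t st.
- by apply: dV; rewrite (le_trans s0)// (itvP xst).
- apply: derivable_within_continuous => x xst.
  have [] // : is_derive x 1 V (kap x).
  by apply: dV; rewrite (le_trans s0)// (itvP xst).
- have c0 : 0 <= c by rewrite (le_trans s0)// (itvP cst).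
  by have /andP[mk kM] := mM _ c0; rewrite !ler_wpM2r ?subr_ge0.
Qed.

End Primitive.

Section Trajectories.
Context {R : realType} {d : nat}.

(** Where the velocity is [k t (g t)] times a control of norm at most [1], the curve
    is no faster than [V]; the other times form a null set, which [increment_le]
    allows since [g] is Lipschitz. *)
Lemma adm_increment (Omega : set 'rV[R]_d) (k : R -> 'rV[R]_d -> R)
    (g : R -> 'rV[R]_d) (V : R -> R) :
  (forall t x, 0 <= t -> closure Omega x -> 0 <= k t x) ->
  adm Omega k g ->
  (forall t : R, 0 <= t -> is_derive t 1 V (k t (g t))) ->
  (forall s t : R, 0 <= s -> s <= t -> V s <= V t) ->
  forall s t, 0 <= s -> s <= t -> enorm (g t - g s) <= V t - V s.
Proof.
move=> k0 [[C gC] gO [u [_ u1 ae_u]]] dV ndV s t s0 st.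
apply: (@increment_le _ _ g V s t `|C| _ st _ ae_u) => //.
- move=> x y /andP[sx _] /andP[sy _].
  by rewrite (le_trans (gC _ _ _ _)) ?(le_trans s0)// ler_wpM2r// ler_norm.
- by move=> x y sx xy _; rewrite ndV// (le_trans s0).
- move=> x /andP[sx xt] /contrapT gx e e0.
  have x0 : 0 <= x by rewrite (le_trans s0).
  have e2 : 0 < e / 2 by rewrite divr_gt0.
  have dg := gx x0; have dVx := dV _ x0.
  set r := k x (g x) in dg dVx.
  have near_g : \forall y \near x^'+,
      enorm (g y - g x - (y - x) *: (r *: u x)) <= e / 2 * `|y - x|.
    by apply: cvg_within; exact: (is_derive_enorm dg e2).
  have near_V : \forall y \near x^'+,
      `|V y - V x - (y - x) *: r| <= e / 2 * `|y - x|.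
    by apply: cvg_within; exact: (is_derive_approx dVx e2).
  near=> y.
  have xy : x < y by near: y; exact: nbhs_right_gt.
  have yx0 : 0 < y - x by rewrite subr_gt0.
  have : enorm (g y - g x - (y - x) *: (r *: u x)) <= e / 2 * `|y - x|.
    by near: y; exact: near_g.
  have : `|V y - V x - (y - x) *: r| <= e / 2 * `|y - x|.
    by near: y; exact: near_V.
  rewrite (gtr0_norm yx0) ler_norml => /andP[hV _] hg.
  have := enorm_triangle (g y - g x) ((y - x) *: (r *: u x)) 0.
  have r0 : 0 <= r by apply: k0 => //; exact: gO.
  rewrite !subr0 !enormZ (gtr0_norm yx0) (ger0_norm r0).
  have : (y - x) * (r * enorm (u x)) <= (y - x) * r.
    by rewrite ler_wpM2l ?(ltW yx0)// ler_piMr// u1.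
  move: hV; rewrite [_ *: r]/GRing.scale/=; lra.
Unshelve. all: by end_near. Qed.

End Trajectories.

(** * Motion along a given path *)

Section Curves.
Context {R : realType} {d : nat}.
Notation mu := (@lebesgue_measure R).

Lemma glue_lipschitz (X Y : R -> 'rV[R]_d) :
  (forall s t, enorm (X s - X t) <= `|s - t|) ->
  (forall s t, enorm (Y s - Y t) <= `|s - t|) -> X 0 = Y 0 ->
  forall s t, enorm ((if s <= 0 then X s else Y s) -
                     (if t <= 0 then X t else Y t)) <= `|s - t|.
Proof.
move=> Xlip Ylip XY.
have mixed s t : s <= 0 -> 0 <= t -> enorm (X s - Y t) <= `|s - t|.
  move=> s0 t0; rewrite (le_trans (enorm_triangle _ (X 0) _))// {2}XY.
  rewrite (le_trans (lerD (Xlip _ _) (Ylip _ _)))//.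
  by rewrite subr0 sub0r normrN ler0_norm// ger0_norm// ler0_norm; lra.
move=> s t; case: ifPn => [s0|]; case: ifPn => [t0|]; rewrite -?ltNge => *.
- exact: Xlip.
- by apply: mixed => //; exact: ltW.
- by rewrite enormC distrC; apply: mixed => //; exact: ltW.
- exact: Ylip.
Qed.

(** A 1-Lipschitz path does not increase the speed, so it suffices to control the
    speed of the position [p] on the path. *)
Lemma adm_reparametrization (Omega : set 'rV[R]_d) (k : R -> 'rV[R]_d -> R)
    (Z : R -> 'rV[R]_d) (p : R -> R) (C : R) :
  {within [set z : R * 'rV[R]_d | 0 <= z.1 /\ closure Omega z.2],
     continuous (fun z : R * 'rV[R]_d => k z.1 z.2)} ->
  (forall t x, 0 <= t -> closure Omega x -> 0 < k t x) ->
  (forall l, closure Omega (Z l)) ->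
  (forall l m, enorm (Z l - Z m) <= `|l - m|) ->
  (forall s t, 0 <= s -> 0 <= t -> `|p s - p t| <= C * `|s - t|) ->
  {ae mu, forall t : R, 0 < t -> forall e, 0 < e ->
    \forall s \near t, `|p s - p t| <= (k t (Z (p t)) + e) * `|s - t|} ->
  adm Omega k (Z \o p).
Proof.
move=> kc k0 ZO Zlip pC p_speed; apply: adm_of_speed => //.
- by exists C => s t s0 t0; rewrite (le_trans (Zlip _ _))// pC.
- by move=> t _; exact: ZO.
- move: p_speed; apply: ae_impl => t pt t0 e e0.
  by apply: filterS (pt t0 e e0) => s; apply: le_trans; exact: Zlip.
Qed.

Lemma value_function_le (Omega Gamma : set 'rV[R]_d) (k : R -> 'rV[R]_d -> R)
    (g : R -> 'rV[R]_d) (t T : R) :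
  adm Omega k g -> 0 <= T -> Gamma (g (T + t)) ->
  (value_function Omega Gamma k t (g t) <= T%:E)%E.
Proof.
move=> gadm T0 gT; apply: (@le_trans _ _ (arrival_time Gamma t g)).
  by apply: ereal_inf_lbound; exists g.
by apply: ereal_inf_lbound; exists T.
Qed.

End Curves.

(** * The law of motion of the pursuer *)

Section PursuitLaw.
Context {R : realType}.

Lemma is_derive_scaled_expR (c L t0 s : R) :
  is_derive s 1 (fun r => c * expR (L * (r - t0))) (L * (c * expR (L * (s - t0)))).
Proof.
have dsub : is_derive s 1 (fun r : R => r - t0) 1.
  by rewrite -[1 in X in is_derive _ _ _ X]subr0; exact: is_deriveB.
have dlin : is_derive s 1 (fun r : R => L * (r - t0)) L.
  by rewrite -[L in X in is_derive _ _ _ X]mulr1; exact: (is_deriveZ L dsub).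
have dexp : is_derive s 1 (fun r => expR (L * (r - t0))) (expR (L * (s - t0)) * L).
  exact: is_derive1_comp.
have := is_deriveZ c dexp; rewrite [_ *: _]/GRing.scale/=.
by rewrite (_ : c * (_ * L) = L * (c * expR (L * (s - t0)))); last by ring.
Qed.

(** The position [p] of the pursuer is counted along the whole path from the point
    where it meets the path of the leader: it moves from [- l] to [0] on the way to
    this point, which it reaches by the time [a], and then up to [V b - V t0].
    Between [a] and [b] it stays at the distance [E] behind the position
    [V - V t0] of the leader, after having waited at [0] as long as the leader is
    closer than that; after [Num.max a b] it completes the journey at the speed
    [Kmin]. As [E] grows at the rate [L * E], the speed of the pursuer is at most
    [kap - L * E] during the pursuit, and the condition [L * E b <= Kmin] keeps this
    quantity nonnegative. The two times where the phases meet are left out. *)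
Lemma pursuit_law (V kap : R -> R) (Kmin Kmax L t0 t1 b l : R) :
  0 < Kmin -> 0 < Kmax -> 0 < L -> 0 <= t0 -> t0 <= b -> 0 <= t1 -> 0 <= l ->
  (forall t : R, 0 <= t -> is_derive t 1 V (kap t)) ->
  (forall t : R, 0 <= t -> Kmin <= kap t <= Kmax) ->
  let a := Num.max t0 t1 + l / Kmin in
  let E := fun t => Kmax * (a - t0) * expR (L * (t - t0)) in
  L * E b <= Kmin ->
  exists p : R -> R,
    [/\ exists C, forall s t, 0 <= s -> 0 <= t -> `|p s - p t| <= C * `|s - t|,
        p t1 = - l,
        exists2 s, t1 <= s <= Num.max a b + E b / Kmin & p s = V b - V t0 &
        forall t, 0 < t -> t != a -> t != Num.max a b -> forall e, 0 < e ->
          (\forall s \near t, `|p s - p t| <= (Kmin + e) * `|s - t|) \/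
          [/\ t0 <= t <= b, 0 <= p t, p t = V t - V t0 - E t &
              \forall s \near t,
                `|p s - p t| <= (kap t - L * E t + e) * `|s - t|]].
Proof.
move=> Kmin0 Kmax0 L0 t00 t0b t10 l0 dV kapK a E small.
have b0 : 0 <= b := le_trans t00 t0b.
have lK : 0 <= l / Kmin by rewrite divr_ge0 ?(ltW Kmin0).
have t0a : t0 <= a.
  by rewrite /a (@le_trans _ _ (Num.max t0 t1)) ?le_max ?lexx// lerDl.
have t1a : t1 + l / Kmin <= a by rewrite /a lerD2r le_max lexx orbT.
have t1a' : t1 <= a by rewrite (le_trans _ t1a)// lerDl.
have a0 : 0 <= a := le_trans t00 t0a.
set A := Num.max a b.
have aA : a <= A by rewrite le_max lexx.
have bA : b <= A by rewrite le_max lexx orbT.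
have VK : forall s t, 0 <= s -> s <= t ->
    Kmin * (t - s) <= V t - V s <= Kmax * (t - s).
  exact: primitive_increment dV kapK.
have ndV s t : 0 <= s -> s <= t -> V s <= V t.
  move=> s0 st; have /andP[h _] := VK s t s0 st.
  by rewrite -subr_ge0 (le_trans _ h)// mulr_ge0 ?subr_ge0 ?(ltW Kmin0).
have Vlip s t : 0 <= s -> 0 <= t -> `|V s - V t| <= Kmax * `|s - t|.
  wlog st : s t / t <= s => [H s_ge0 t_ge0|s_ge0 t_ge0].
    have [ts|/ltW ts] := leP t s; first exact: H.
    by rewrite distrC (distrC s); exact: H.
  have /andP[_ VM] := VK _ _ t_ge0 st.
  by rewrite !ger0_norm ?subr_ge0 ?ndV.
set c := Kmax * (a - t0).
have c0 : 0 <= c by rewrite mulr_ge0 ?subr_ge0 ?(ltW Kmax0).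
have E0 t : 0 <= E t by rewrite mulr_ge0 ?expR_ge0.
have cE t : t0 <= t -> c <= E t.
  move=> t0t; rewrite /E ler_peMr// -expR0 ler_expR.
  by rewrite mulr_ge0 ?subr_ge0 ?(ltW L0).
have ndE s t : s <= t -> E s <= E t.
  by move=> st; rewrite ler_wpM2l// ler_expR ler_wpM2l ?lerD2r ?(ltW L0).
have Elip s t : s <= b -> t <= b -> `|E s - E t| <= E b * L * `|s - t|.
  move=> sb tb; rewrite /E -/c -mulrBr normrM (ger0_norm c0).
  rewrite (_ : _ * L * _ = c * (expR (L * (b - t0)) * (L * `|s - t|))); last ring.
  rewrite ler_wpM2l//.
  rewrite (le_trans (@expR_lipschitz R (L * (b - t0)) _ _ _ _))//.
  - by rewrite ler_wpM2l ?lerD2r ?(ltW L0).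
  - by rewrite ler_wpM2l ?lerD2r ?(ltW L0).
  - by rewrite -mulrBr normrM (gtr0_norm L0) opprB addrA subrK.
(* the way to the meeting point *)
pose F s := Num.min l (Kmin * Num.max 0 (s - t1)).
(* the pursuit *)
pose m s := Num.max 0 (V s - V t0 - E s).
(* the pursuit stopped at time [b], then the rest at the speed [Kmin] *)
pose q s := Num.min (V b - V t0) (m (Num.min b s) + Kmin * Num.max 0 (s - A)).
pose p s := F s - l + q s.
have Vb0 : 0 <= V b - V t0 by rewrite subr_ge0 ndV.
have m0 s : 0 <= m s by rewrite le_max lexx.
have mV s : t0 <= s -> m s <= V s - V t0.
  by move=> t0s; rewrite ge_max subr_ge0 ndV//= gerBl.
have rampK r s t : `|Kmin * Num.max 0 (s - r) - Kmin * Num.max 0 (t - r)|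
    <= Kmin * `|s - t|.
  rewrite -mulrBr normrM (gtr0_norm Kmin0) ler_wpM2l ?(ltW Kmin0)//.
  by rewrite (le_trans (max_lipschitz _ _ _))// opprB addrA subrK.
have FK s t : `|F s - F t| <= Kmin * `|s - t|.
  by rewrite (le_trans (min_lipschitz _ _ _)).
have Fa s : a <= s -> F s = l.
  move=> as_; apply/min_idPl; rewrite (max_idPr _); last first.
    by rewrite subr_ge0 (le_trans t1a').
  by rewrite mulrC -ler_pdivrMr// lerBrDl (le_trans t1a).
(* at time [a] the leader is still at a distance at most [E] *)
have qa s : 0 <= s -> s <= a -> q s = 0.
  move=> s0 sa; rewrite /q; have -> : m (Num.min b s) = 0.
    apply/max_idPl; rewrite subr_le0.
    have [rt0|t0r] := leP (Num.min b s) t0.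
      by rewrite (le_trans _ (E0 _))// subr_le0 ndV// le_min b0.
    have /andP[_ VM] := VK _ _ t00 (ltW t0r).
    rewrite (le_trans VM)// (le_trans _ (cE _ (ltW t0r)))//.
    by rewrite ler_wpM2l ?(ltW Kmax0)// lerD2r ge_min sa orbT.
  rewrite (max_idPl _) ?mulr0 ?addr0; last first.
    by rewrite subr_le0 (le_trans sa).
  exact/min_idPr.
exists p; split.
- exists (Kmin + ((Kmax + E b * L) + Kmin)) => s t s0 t0'.
  have -> : p s - p t = (F s - F t) + (q s - q t) by rewrite /p; ring.
  rewrite mulrDl (le_trans (ler_normD _ _))// lerD//.
  rewrite (le_trans (min_lipschitz _ _ _))//.
  rewrite opprD addrACA mulrDl (le_trans (ler_normD _ _))// lerD//.
  have sb : Num.min b s <= b by rewrite ge_min lexx.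
  have tb : Num.min b t <= b by rewrite ge_min lexx.
  have s_ge0 : 0 <= Num.min b s by rewrite le_min b0.
  have t_ge0 : 0 <= Num.min b t by rewrite le_min b0.
  rewrite (le_trans (max_lipschitz _ _ _))//.
  rewrite (@le_trans _ _ ((Kmax + E b * L) * `|Num.min b s - Num.min b t|))//.
    rewrite mulrDl (le_trans _ (lerD (Vlip _ _ s_ge0 t_ge0) (Elip _ _ sb tb)))//.
    rewrite (le_trans _ (ler_normB _ _))// le_eqVlt; apply/orP; left; apply/eqP.
    by congr (`|_|); ring.
  apply: ler_wpM2l; last exact: min_lipschitz.
  by apply: addr_ge0; [exact: ltW|apply: mulr_ge0; [exact: E0|exact: ltW]].
- by rewrite /p qa// /F subrr maxxx mulr0 (min_idPr l0) sub0r addr0.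
- pose s := A + (V b - V t0 - m b) / Kmin.
  have Vm : 0 <= V b - V t0 - m b by rewrite subr_ge0 mV.
  have mE : V b - V t0 - m b <= E b.
    by rewrite lerBlDr -lerBlDl le_max lexx orbT.
  have As : A <= s by rewrite lerDl divr_ge0 ?(ltW Kmin0).
  exists s.
    rewrite (le_trans t1a' (le_trans aA As))/= lerD2l.
    by rewrite ler_wpM2r ?invr_ge0 ?(ltW Kmin0).
  rewrite /p Fa ?(le_trans aA)// subrr add0r /q (min_idPl (le_trans bA As)).
  rewrite (max_idPr _) ?subr_ge0// /s [A + _]addrC addrK mulrCA divff ?gt_eqF//.
  by rewrite mulr1 [m _ + _]addrC subrK minxx.
move=> t t_gt0 ta tA e e0.
have Ke : Kmin <= Kmin + e by rewrite lerDl ltW.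
have [ta'|ta'|/eqP] := ltgtP t a; last by rewrite (negbTE ta).
  left; near=> s.
  have sa : s <= a by apply/ltW; near: s; exact: lt_nbhsl.
  have s0 : 0 <= s by apply/ltW; near: s; exact: lt_nbhsr.
  have -> : p s - p t = F s - F t.
    by rewrite /p (qa s)// (qa t) ?(ltW t_gt0) ?(ltW ta')//; ring.
  by rewrite (le_trans (FK _ _))// ler_wpM2r.
have [tA'|tA'|/eqP] := ltgtP t A; last by rewrite (negbTE tA).
  have Ab : A = b.
    apply/max_idPr; rewrite leNgt; apply: contraTN tA' => ba.
    by rewrite -leNgt /A (max_idPl (ltW ba)) ltW.
  have pm s : a <= s -> s <= A -> p s = m s.
    move=> as_ sA; rewrite /p Fa// subrr add0r /q.
    rewrite (max_idPl _) ?subr_le0// mulr0 addr0.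
    rewrite -Ab (min_idPr sA) (min_idPr _)//.
    rewrite Ab (le_trans (mV _ _)) ?(le_trans t0a)//.
    by rewrite lerD2r ndV ?(le_trans a0)// -Ab.
  have near_pm : \forall s \near t, p s = m s.
    near=> s.
    have sa : a <= s by apply/ltW; near: s; exact: lt_nbhsr.
    have sA : s <= A by apply/ltW; near: s; exact: lt_nbhsl.
    exact: pm.
  pose y s := V s - V t0 - E s.
  have dy : is_derive t 1 y (kap t - L * E t).
    have dVt : is_derive t 1 (fun s => V s - V t0) (kap t).
      rewrite -[kap t]subr0; apply: is_deriveB; exact: dV (ltW t_gt0).
    exact: is_deriveB dVt (is_derive_scaled_expR c L t0 t).
  have [y0|y0] := ltP (y t) 0.
    left; have near_y : \forall s \near t, y s < 0.
      have cy : {for t, continuous y}.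
        by apply/differentiable_continuous/derivable1_diffP; case: dy.
      have yt : y s @[s --> t] --> y t := cy.
      exact: (cvgr_lt _ yt).
    near=> s.
    have -> : p s = m s by near: s.
    have ys : y s < 0 by near: s.
    rewrite pm ?(ltW ta') ?(ltW tA')// /m (max_idPl (ltW y0)) (max_idPl (ltW ys)).
    by rewrite subrr normr0 mulr_ge0// (le_trans (ltW Kmin0)).
  right; have pt : p t = y t by rewrite pm ?(ltW ta') ?(ltW tA')// /m (max_idPr y0).
  split => //.
  - by rewrite (le_trans t0a) ?(ltW ta')//= -Ab ltW.
  - by rewrite pt.
  have near_dy := is_derive_approx dy e0.
  near=> s.
  have -> : p s = m s by near: s.
  have ys : `|y s - y t - (s - t) *: (kap t - L * E t)| <= e * `|s - t|.
    by near: s.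
  rewrite pm ?(ltW ta') ?(ltW tA')// (le_trans (max_lipschitz _ _ _))//.
  have speed : 0 <= kap t - L * E t.
    have /andP[kt _] := kapK _ (ltW t_gt0); rewrite subr_ge0 (le_trans _ kt)//.
    by rewrite (le_trans _ small)// ler_wpM2l ?(ltW L0)// ndE// -Ab ltW.
  rewrite -/(y s) -/(y t) mulrDl -[y s - y t](subrK ((s - t) *: (kap t - L * E t))).
  rewrite (le_trans (ler_normD _ _))// addrC lerD//.
  by rewrite normrZ (ger0_norm speed) mulrC.
left; near=> s.
have sA : A <= s by apply/ltW; near: s; exact: lt_nbhsr.
have tA2 := ltW tA'.
rewrite /p !Fa ?(le_trans aA)// !subrr !add0r /q !(min_idPl (le_trans bA _))//.
rewrite (le_trans (min_lipschitz _ _ _))// opprD addrACA subrr add0r.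
by rewrite (le_trans (rampK _ _ _))// ler_wpM2r.
Unshelve. all: by end_near. Qed.

End PursuitLaw.

(** * Regularity of the value function *)

Section MinimalTime.
Context {R : realType} {d : nat}.
Context (Omega Gamma : set 'rV[R]_d) (k : R -> 'rV[R]_d -> R).
Context (D Kmin Kmax L : R).
Context (D_gt0 : 0 < D)
  (geodesic : forall x y : 'rV[R]_d, closure Omega x -> closure Omega y ->
    connected_by_curve (closure Omega) x y (D * enorm (x - y)))
  (k_continuous :
    {within [set z : R * 'rV[R]_d | 0 <= z.1 /\ closure Omega z.2],
      continuous (fun z : R * 'rV[R]_d => k z.1 z.2)})
  (Kmin_gt0 : 0 < Kmin) (Kmax_gt0 : 0 < Kmax)
  (k_bounds : forall (t : R) (x : 'rV[R]_d), 0 <= t -> closure Omega x ->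
    Kmin <= k t x <= Kmax)
  (L_gt0 : 0 < L)
  (k_lipschitz : forall (t : R) (x1 x2 : 'rV[R]_d), 0 <= t ->
    closure Omega x1 -> closure Omega x2 ->
    `|k t x1 - k t x2| <= L * enorm (x1 - x2)).

Lemma k_gt0 t x : 0 <= t -> closure Omega x -> 0 < k t x.
Proof. by move=> t0 Ox; have /andP[/(lt_le_trans Kmin_gt0)] := k_bounds t0 Ox. Qed.

(** Travelling at the speed [Kmin] is always allowed. *)
Lemma value_function_bound t x y : 0 <= t -> closure Omega x -> Gamma y ->
  closure Omega y ->
  (value_function Omega Gamma k t x <= (D * enorm (x - y) / Kmin)%:E)%E.
Proof.
move=> t0 Ox Gy Oy.
have [X [XO Xlip X0 Xl]] := geodesic_parametrization (geodesic Ox Oy).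
set l := D * _ in Xl *.
have l0 : 0 <= l by rewrite mulr_ge0 ?enorm_ge0 ?ltW.
pose p s := Num.min l (Kmin * Num.max 0 (s - t)).
have pK s r : `|p s - p r| <= Kmin * `|s - r|.
  rewrite (le_trans (min_lipschitz _ _ _))// -mulrBr normrM gtr0_norm//.
  rewrite ler_wpM2l ?(ltW Kmin_gt0)// (le_trans (max_lipschitz _ _ _))//.
  by rewrite opprB addrA subrK.
have Xadm : adm Omega k (X \o p).
  apply: (@adm_reparametrization _ _ _ _ _ _ Kmin) => //; first exact: k_gt0.
  apply: aeW => s s0 e e0; near=> r.
  rewrite (le_trans (pK _ _))// ler_wpM2r//.
  by have /andP[] := k_bounds (ltW s0) (XO (p s)); lra.
have pt : p t = 0 by rewrite /p subrr maxxx mulr0 (min_idPr l0).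
have lK0 : 0 <= l / Kmin by rewrite divr_ge0 ?(ltW Kmin_gt0).
have Xarr : Gamma ((X \o p) (l / Kmin + t)).
  rewrite /= /p addrK (max_idPr lK0) mulrCA divff ?gt_eqF// mulr1 minxx.
  by rewrite Xl.
have := value_function_le Xadm lK0 Xarr.
by rewrite /= pt X0.
Unshelve. all: by end_near. Qed.

(** The pursuer moves by [pursuit_law] on the path [Z], made of a curve [X] from
    [x1] to [g t0] and of the path [Y] of [g]. A point of [Y] at arclength distance
    [E t] behind [g t] is at Euclidean distance at most [E t] from it, so the speed
    allowed there is at least [k t (g t) - L * E t]. *)
Lemma pursuit (g : R -> 'rV[R]_d) (t0 t1 T Q : R) (x1 : 'rV[R]_d) :
  adm Omega k g -> 0 <= t0 -> 0 <= T -> Gamma (g (T + t0)) ->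
  0 <= t1 -> closure Omega x1 -> expR (L * T) <= Q ->
  let delta := `|t0 - t1| + D * enorm (x1 - g t0) / Kmin in
  L * (Kmax * delta * Q) <= Kmin ->
  (value_function Omega Gamma k t1 x1 <=
   (T + `|t0 - t1| + delta * (1 + Kmax * Q / Kmin))%:E)%E.
Proof.
move=> gadm t00 T0 gT t10 Ox1 TQ delta small.
have [[C gC] gO _] := gadm.
have gL : lipschitz_curve g by exists C.
pose b := T + t0.
have t0b : t0 <= b by rewrite lerDr.
have b0 : 0 <= b by rewrite addr_ge0.
have Ox0 : closure Omega (g t0) by exact: gO.
have kapc := curve_speed_continuous k_continuous gL gO.
have [V dV'] := continuous_primitive kapc.
have dV (t : R) : 0 <= t -> is_derive t 1 V (k t (g t)).
  by move=> t_ge0; have := dV' t t_ge0; rewrite (max_idPr t_ge0).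
have kg t : 0 <= t -> Kmin <= k t (g t) <= Kmax.
  by move=> t_ge0; exact: k_bounds (gO t t_ge0).
have ndV s t : 0 <= s -> s <= t -> V s <= V t.
  move=> s0 st; have /andP[h _] := primitive_increment dV kg s0 st.
  by rewrite -subr_ge0 (le_trans _ h)// mulr_ge0 ?subr_ge0 ?(ltW Kmin_gt0).
have gV := adm_increment (fun t x tx Ox => ltW (k_gt0 tx Ox)) gadm dV ndV.
have [|t /andP[tt0 tb] e e0|s t s0 st _|Y [YO' Ylip YV _ _]] :=
    @arclength_parametrization R d g V t0 b.
- exact: t0b.
- have C1 : 0 < `|C| + 1 by rewrite ltr_wpDl.
  near=> s => /andP[st0 sb].
  rewrite (le_trans (gC _ _ _ _)) ?(le_trans t00)//.
  rewrite (@le_trans _ _ ((`|C| + 1) * `|s - t|))//.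
    by rewrite ler_wpM2r// (le_trans (ler_norm _))// lerDl.
  rewrite -ler_pdivlMl// distrC; near: s.
  apply: cvgr_dist_le; last by rewrite mulr_gt0// invr_gt0.
  exact: cvg_id.
- exact: gV (le_trans t00 s0) st.
have YO l : closure Omega (Y l).
  have [t /andP[tt0 _] ->] := YO' l.
  exact: gO (le_trans t00 tt0).
have [X [XO Xlip X0 Xl]] := geodesic_parametrization (geodesic Ox1 Ox0).
set l := D * _ in Xl delta small *.
have l0 : 0 <= l by rewrite mulr_ge0 ?enorm_ge0 ?ltW.
(* [X] occupies the positions [- l, 0], and [Y] the nonnegative ones *)
pose Z s := if s <= 0 then X (s + l) else Y (V t0 + s).
have YV0 : Y (V t0) = g t0 by rewrite YV// lexx.
have ZO s : closure Omega (Z s) by rewrite /Z; case: ifP.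
have Zlip s t : enorm (Z s - Z t) <= `|s - t|.
  apply: (@glue_lipschitz _ _ (fun s => X (s + l)) (fun s => Y (V t0 + s))).
  - by move=> x y; rewrite (le_trans (Xlip _ _))// opprD addrACA subrr addr0.
  - by move=> x y; rewrite (le_trans (Ylip _ _))// opprD addrACA subrr add0r.
  - by rewrite add0r addr0 Xl YV0.
have ZY s : 0 <= s -> Z s = Y (V t0 + s).
  rewrite le_eqVlt => /predU1P[<-|s0]; last by rewrite /Z leNgt s0.
  by rewrite /Z lexx add0r addr0 Xl YV0.
pose a := Num.max t0 t1 + l / Kmin.
pose E t := Kmax * (a - t0) * expR (L * (t - t0)).
have a_delta : a - t0 <= delta.
  rewrite /a /delta -addrAC lerD2r.
  have := ler_norm (t1 - t0); rewrite distrC.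
  by case: (leP t0 t1) => // ? ?; rewrite subrr.
have a_t0 : 0 <= a - t0.
  rewrite subr_ge0 /a (@le_trans _ _ (Num.max t0 t1)) ?le_max ?lexx//.
  by rewrite lerDl divr_ge0 ?(ltW Kmin_gt0).
have Eb : E b <= Kmax * delta * Q.
  rewrite /E /b addrK ler_pM ?expR_ge0 ?mulr_ge0 ?(ltW Kmax_gt0)//.
  by rewrite ler_wpM2l ?(ltW Kmax_gt0).
have smallE : L * E b <= Kmin.
  by rewrite (le_trans _ small)// ler_wpM2l ?(ltW L_gt0).
have [p [[K pK] pt1 [s /andP[t1s sb] ps] p_speed]] :=
  pursuit_law Kmin_gt0 Kmax_gt0 L_gt0 t00 t0b t10 l0 dV kg smallE.
have Zadm : adm Omega k (Z \o p).
  apply: (adm_reparametrization k_continuous k_gt0 ZO Zlip pK).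
  apply: ae_impl (ae_and (ae_neq a) (ae_neq (Num.max a b))) => t [ta tA] t_gt0 e e0.
  have kZ : Kmin <= k t (Z (p t)).
    by have /andP[] := k_bounds (ltW t_gt0) (ZO (p t)).
  have [|[/andP[tt0 tb] pt0 ptE]] := p_speed t t_gt0 ta tA e e0.
    by apply: filterS => r /le_trans; apply; rewrite ler_wpM2r// lerD2r.
  apply: filterS => r /le_trans; apply; rewrite ler_wpM2r// lerD2r.
  rewrite lerBlDr -lerBlDl.
  have gO_t := gO _ (ltW t_gt0).
  rewrite (le_trans (ler_norm _))//.
  rewrite (le_trans (k_lipschitz (ltW t_gt0) gO_t (ZO _)))//.
  rewrite ler_wpM2l ?(ltW L_gt0)// ZY// -YV ?tt0// (le_trans (Ylip _ _))//.
  rewrite ptE -/(E t) (_ : V t - _ = E t); last by ring.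
  by rewrite ger0_norm// /E !mulr_ge0 ?expR_ge0 ?(ltW Kmax_gt0).
have st1 : 0 <= s - t1 by rewrite subr_ge0.
have Zs : Gamma ((Z \o p) (s - t1 + t1)).
  rewrite subrK /= ps ZY ?subr_ge0 ?ndV// addrC subrK YV ?t0b ?lexx//.
have := value_function_le Zadm st1 Zs.
rewrite /= pt1 /Z oppr_le0 l0 addNr X0 => /le_trans; apply.
rewrite lee_fin.
have maxab : Num.max a b <= b + delta.
  by rewrite ge_max; apply/andP; split; lra.
have EbK : E b / Kmin <= delta * (Kmax * Q / Kmin).
  rewrite (_ : delta * _ = Kmax * delta * Q / Kmin); last by ring.
  by rewrite ler_wpM2r ?invr_ge0 ?(ltW Kmin_gt0).
have := ler_norm (t0 - t1).
have bE : b = T + t0 by [].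
have sE : s <= Num.max a b + E b / Kmin by [].
rewrite mulrDr mulr1; move: maxab EbK sE bE.
move: (E b / Kmin) (Num.max a b) (delta * (Kmax * Q / Kmin)) => *; lra.
Unshelve. all: by end_near. Qed.

Lemma value_function_ge0 t x : (0 <= value_function Omega Gamma k t x)%E.
Proof.
apply: le_ereal_inf_tmp => _ [g _ <-]; apply: le_ereal_inf_tmp => _ [s [s0 _] <-].
by rewrite lee_fin.
Qed.

Lemma value_function_lt_adm t x (r : R) :
  (value_function Omega Gamma k t x < r%:E)%E ->
  exists g T, [/\ adm Omega k g, g t = x, 0 <= T, T < r & Gamma (g (T + t))].
Proof.
move=> /ereal_inf_lt[_ [g [gadm gx] <-]] /ereal_inf_lt[_ [T [T0 gT] <-]] Tr.
by exists g, T; split.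
Qed.

(** When the data are close, [pursuit] applies to almost minimal trajectories;
    when they are far apart, the uniform bound [T0] on the value function
    suffices. *)
Lemma value_function_le_shift (T0 : R) : 0 <= T0 ->
  (forall t x, 0 <= t -> closure Omega x ->
    (value_function Omega Gamma k t x <= T0%:E)%E) ->
  exists2 M : R, 0 < M & forall t0 t1 x0 x1,
    0 <= t0 -> closure Omega x0 -> 0 <= t1 -> closure Omega x1 ->
    (value_function Omega Gamma k t1 x1 <=
     value_function Omega Gamma k t0 x0 +
     (M * (`|t0 - t1| + enorm (x0 - x1)))%:E)%E.
Proof.
move=> T00 valT0.
pose Q := expR (L * (T0 + 1)).
have Q0 : 0 < Q by exact: expR_gt0.
pose C := 1 + D / Kmin.
have C0 : 0 < C by rewrite addr_gt0 ?divr_gt0.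
pose B := L * (Kmax * C * Q) / Kmin.
have B0 : 0 < B by rewrite divr_gt0// mulr_gt0// mulr_gt0// mulr_gt0.
pose N := 1 + C * (1 + Kmax * Q / Kmin).
have N0 : 0 < N.
  by rewrite /N addr_gt0// mulr_gt0// addr_gt0// divr_gt0// mulr_gt0.
exists (N + T0 * B); first by rewrite ltr_pwDl// mulr_ge0// ltW.
move=> t0 t1 x0 x1 t0_ge0 Ox0 t1_ge0 Ox1.
set rho := _ + enorm _.
have rho0 : 0 <= rho by rewrite addr_ge0 ?enorm_ge0.
have val_fin : value_function Omega Gamma k t0 x0 \is a fin_num.
  rewrite ge0_fin_numE ?value_function_ge0//.
  by rewrite (le_lt_trans (valT0 _ _ t0_ge0 Ox0))// ltry.
have [far|near_] := ltP 1 (B * rho).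
  rewrite (le_trans (valT0 _ _ t1_ge0 Ox1))//.
  rewrite -[leLHS]add0e leeD ?value_function_ge0// lee_fin mulrDl.
  rewrite ler_wpDl ?mulr_ge0 ?(ltW N0)// -mulrA.
  by rewrite ler_peMr// ltW.
apply/lee_addgt0Pr => e e0.
pose h := Num.min e 1.
have h0 : 0 < h by rewrite lt_min e0 ltr01.
have he : h <= e by rewrite ge_min lexx.
have h1 : h <= 1 by rewrite ge_min lexx orbT.
have /value_function_lt_adm[g [T [gadm gx0 T_ge0 Tlt gT]]] :
    (value_function Omega Gamma k t0 x0 <
     (fine (value_function Omega Gamma k t0 x0) + h)%:E)%E.
  by rewrite EFinD fineK// lteDl.
have vT0 : fine (value_function Omega Gamma k t0 x0) <= T0.
  by rewrite -lee_fin fineK// valT0.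
have TQ : expR (L * T) <= Q.
  by rewrite ler_expR ler_wpM2l ?(ltW L_gt0)//; lra.
pose delta := `|t0 - t1| + D * enorm (x1 - g t0) / Kmin.
have delta_rho : delta <= C * rho.
  rewrite /delta gx0 enormC /C /rho mulrDl mul1r mulrAC.
  have : 0 <= D / Kmin * `|t0 - t1|.
    by rewrite mulr_ge0 ?divr_ge0 ?(ltW D_gt0) ?(ltW Kmin_gt0).
  have := enorm_ge0 (x0 - x1).
  by rewrite mulrDr; lra.
have small : L * (Kmax * delta * Q) <= Kmin.
  have : Kmin * (B * rho) <= Kmin * 1 by rewrite ler_wpM2l ?(ltW Kmin_gt0).
  rewrite mulr1; apply: le_trans.
  rewrite (_ : Kmin * (B * rho) = L * (Kmax * (C * rho) * Q)); last first.
    by rewrite /B; field; rewrite gt_eqF.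
  rewrite ler_wpM2l ?(ltW L_gt0)// ler_wpM2r ?(ltW Q0)//.
  by rewrite ler_wpM2l ?(ltW Kmax_gt0).
have := pursuit gadm t0_ge0 T_ge0 gT t1_ge0 Ox1 TQ small.
move=> /le_trans; apply.
rewrite -[X in (_ <= X + _ + _)%E]fineK// -!EFinD lee_fin.
have : delta * (1 + Kmax * Q / Kmin) <= C * rho * (1 + Kmax * Q / Kmin).
  rewrite ler_wpM2r// addr_ge0// divr_ge0 ?(ltW Kmin_gt0)//.
  by rewrite mulr_ge0 ?(ltW Q0) ?(ltW Kmax_gt0).
have : 0 <= T0 * B * rho by rewrite mulr_ge0// mulr_ge0// ltW.
have : `|t0 - t1| <= rho by rewrite lerDl enorm_ge0.
rewrite -/delta /N.
have -> : (1 + C * (1 + Kmax * Q / Kmin) + T0 * B) * rho =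
  rho + C * rho * (1 + Kmax * Q / Kmin) + T0 * B * rho by ring.
lra.
Qed.

End MinimalTime.

Lemma ereal_dist_le (R : realType) (u v : \bar R) (r : R) :
  u \is a fin_num -> v \is a fin_num ->
  (u <= v + r%:E)%E -> (v <= u + r%:E)%E -> (`|u - v| <= r%:E)%E.
Proof.
case: u v => [u| |] [v| |]//= _ _; rewrite -!EFinD !lee_fin => uv vu.
by rewrite ler_norml; apply/andP; split; lra.
Qed.

Theorem proposition3p3 (R : realType) (d : nat)
  (Omega Gamma : set 'rV[R]_d) (k : R -> 'rV[R]_d -> R)
  (D Kmin Kmax L : R)
  (Omega_neq0 : Omega !=set0)
  (Omega_open : open Omega)
  (Omega_bounded : bounded_set Omega)
  (Omega_connected : connected Omega)
  (D_gt0 : 0 < D)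
  (Omega_geodesic : forall x y : 'rV[R]_d,
     closure Omega x -> closure Omega y ->
     connected_by_curve (closure Omega) x y (D * enorm (x - y)))
  (Gamma_sub : Gamma `<=` closure Omega)
  (Gamma_neq0 : Gamma !=set0)
  (Gamma_closed : closed Gamma)
  (k_continuous :
     {within [set z : R * 'rV[R]_d | 0 <= z.1 /\ closure Omega z.2],
       continuous (fun z : R * 'rV[R]_d => k z.1 z.2)})
  (Kmin_gt0 : 0 < Kmin)
  (Kmax_gt0 : 0 < Kmax)
  (k_bounds : forall (t : R) (x : 'rV[R]_d), 0 <= t -> closure Omega x ->
     Kmin <= k t x <= Kmax)
  (L_gt0 : 0 < L)
  (k_lipschitz : forall (t : R) (x1 x2 : 'rV[R]_d), 0 <= t ->
     closure Omega x1 -> closure Omega x2 ->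
     `|k t x1 - k t x2| <= L * enorm (x1 - x2)) :
  exists M : R, 0 < M /\
    forall (t0 t1 : R) (x0 x1 : 'rV[R]_d),
      0 <= t0 -> closure Omega x0 -> 0 <= t1 -> closure Omega x1 ->
      (`|value_function Omega Gamma k t0 x0
          - value_function Omega Gamma k t1 x1|
       <= (M * (`|t0 - t1| + enorm (x0 - x1)))%:E)%E.
Proof.
have [r r0 Or] := bounded_enorm Omega_bounded.
have [y Gy] := Gamma_neq0.
have T0_ge0 : 0 <= D * r / Kmin.
  by rewrite divr_ge0 ?mulr_ge0 ?(ltW D_gt0) ?(ltW Kmin_gt0).
have value_le t x : 0 <= t -> closure Omega x ->
    (value_function Omega Gamma k t x <= (D * r / Kmin)%:E)%E.
  move=> t0 Ox; have Oy := Gamma_sub y Gy.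
  rewrite (le_trans (value_function_bound D_gt0 Omega_geodesic k_continuous
    Kmin_gt0 k_bounds t0 Ox Gy Oy))// lee_fin.
  rewrite ler_wpM2r ?invr_ge0 ?(ltW Kmin_gt0)//.
  by rewrite ler_wpM2l ?(ltW D_gt0)// Or.
have value_fin t x : 0 <= t -> closure Omega x ->
    value_function Omega Gamma k t x \is a fin_num.
  move=> t0 Ox; rewrite ge0_fin_numE ?value_function_ge0//.
  by rewrite (le_lt_trans (value_le t x t0 Ox))// ltry.
have [M M0 value_shift] := value_function_le_shift D_gt0 Omega_geodesic
  k_continuous Kmin_gt0 Kmax_gt0 k_bounds L_gt0 k_lipschitz T0_ge0 value_le.
exists M; split => // t0 t1 x0 x1 t0_ge0 Ox0 t1_ge0 Ox1.
apply: ereal_dist_le; [exact: value_fin|exact: value_fin| |exact: value_shift].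
by rewrite distrC enormC; exact: value_shift.
Qed.
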